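(* Let $n\ge3$ and $T_0,\ldots,T_n\in\mathcal{T}^2_2$ be such that $K=D(T_0\ast T_1\ast\cdots\ast T_n)$ is a knot. Suppose that for all $t$ in the complement of a finite subset of $\mathbb{C}$ there exist $\varrho_i\in\mathcal{R}_t(T_i)$, $0\le i\le n$, such that $\mathbf{g}_{\varrho_i}=\mathbf{e}$ for $0\le i\le n$ and $\mathrm{tr}_v(\varrho_i)\notin\{2,t^2-2\}$ for $1\le i\le n$. Then $$\dim\mathcal{X}^{\rm irr}(K)\ge\begin{cases} n-1, & \text{if } \varrho_0(T_0^{\rm ne})\varrho_0(T_0^{\rm se})\neq\varrho_0(T_0^{\rm se})\varrho_0(T_0^{\rm ne}),\\ n-2, & \text{if } \varrho_0(T_0^{\rm ne})\varrho_0(T_0^{\rm se})=\varrho_0(T_0^{\rm se})\varrho_0(T_0^{\rm ne}).\end{cases}$$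
   Context: $G=\mathrm{SL}(2,\mathbb{C})$, $\mathbf{e}$ the identity; $G(t)=\{\mathbf{x}\in G\setminus\{\pm\mathbf{e}\}\colon\mathrm{tr}(\mathbf{x})=t\}$; $\mathbf{a}\lrcorner\mathbf{b}=\mathbf{a}\mathbf{b}\mathbf{a}^{-1}$. For a knot $K\subset S^3$, $\pi(K)$ is the fundamental group of its exterior; $\mathcal{X}^{\rm irr}(K)$ is the set of characters $\chi_\rho\colon g\mapsto\mathrm{tr}\rho(g)$ of irreducible homomorphisms $\rho\colon\pi(K)\to G$ (irreducible = image has no common eigenvector), a Zariski open subset of the $\mathrm{SL}(2,\mathbb{C})$-character variety; its dimension is the maximum dimension of its components. $\mathcal{T}^2_2$ is the set of tangle diagrams in a disk with four ends, called northwest, northeast, southwest, southeast; $T^{\rm nw},T^{\rm ne},T^{\rm sw},T^{\rm se}$ denote the arcs at these ends, each directed outward. A representation of a tangle (or link) diagram is an assignment $\rho$ of an element $\rho(\mathsf{a})\in G$ to each directed arc $\mathsf{a}$ such that $\rho(\mathsf{a}^{-1})=\rho(\mathsf{a})^{-1}$ (where $\mathsf{a}^{-1}$ is the arc with reversed direction) and, at each crossing with overarc $\mathsf{a}$ and underarcs $\mathsf{b}$ (incoming) and $\mathsf{c}$ (outgoing), oriented in the standard Wirtinger way, $\rho(\mathsf{c})=\rho(\mathsf{a})\lrcorner\rho(\mathsf{b})$; for a knot this is the same as a homomorphism $\pi(K)\to G$ via the Wirtinger presentation. $\mathcal{R}_t(T)$ is the set of representations of $T$ with $\rho(\mathsf{a})\in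 G(t)$ for every directed arc $\mathsf{a}$. For $\rho$ a representation of $T\in\mathcal{T}^2_2$: $\mathbf{g}_\rho=\rho(T^{\rm nw})\rho(T^{\rm ne})$ and $\mathrm{tr}_v(\rho)=\mathrm{tr}(\rho(T^{\rm sw})\rho(T^{\rm nw}))$. Operations: the vertical composite $T_1\ast T_2$ places $T_1$ above $T_2$ and joins the SW end of $T_1$ to the NW end of $T_2$ and the SE end of $T_1$ to the NE end of $T_2$ (this is associative). The denominator $D(T)$ is the link obtained from $T$ by joining its NW end to its SW end and its NE end to its SE end by arcs outside the disk; the numerator $N(T)$ joins NW to NE and SW to SE. *)

(* Defs.v *)
From mathcomp Require Import all_boot all_algebra.
From mathcomp Require Import complex.
From mathcomp Require Import Rstruct.
From mathcomp Require mpoly.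
From Stdlib Require Import Relations.

Set Implicit Arguments.
Unset Strict Implicit.
Unset Printing Implicit Defensive.
Import GRing.Theory.
Local Open Scope ring_scope.

Definition C : numClosedFieldType := (Rdefinitions.R)[i].
Definition M2 := 'M[C]_2.

Definition inSL2 (x : M2) : Prop := \det x = 1.

Definition inGt (t : C) (x : M2) : Prop :=
  [/\ \det x = 1, x <> 1%:M, x <> - 1%:M & \tr x = t].

(** * Tangle diagrams (Morse / "elementary slice" presentation)

   A (planar) diagram is a word in elementary horizontal slices, read from
   top to bottom.  A level of width [w] consists of [w] points, numbered
   0..w-1 from left to right.
   - [Cross i b] : the strands at positions i and i+1 cross (each moves to the
     other position); if [b] the strand going from position i (top) to
     position i+1 (bottom) is the overstrand, otherwise the strand going from
     position i+1 to position i is the overstrand.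
   - [Birth i]   : a local maximum creating two new points at positions i, i+1.
   - [Death i]   : a local minimum joining the points at positions i, i+1.
   All other strands go straight down. *)
Inductive piece : Type :=
  | Cross of nat & bool
  | Birth of nat
  | Death of nat.

Definition diagram := seq piece.

Definition piece_ok (w : nat) (p : piece) : bool :=
  match p with
  | Cross i _ => i.+1 < w
  | Birth i => i <= w
  | Death i => i.+1 < w
  end%N.

Definition piece_width (w : nat) (p : piece) : nat :=
  match p with
  | Cross _ _ => w
  | Birth _ => w.+2
  | Death _ => w.-2
  end.

Fixpoint valid (w : nat) (s : diagram) (w' : nat) : bool :=
  match s with
  | [::] => w == w'
  | p :: s' => piece_ok w p && valid (piece_width w p) s' w'
  end.

Definition wid (w0 : nat) (s : diagram) (k : nat) : nat :=
  foldl piece_width w0 (take k s).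

Definition point_ok (w0 : nat) (s : diagram) (q : nat * nat) : Prop :=
  (q.1 <= size s)%N /\ (q.2 < wid w0 s q.1)%N.

(** T in T^2_2 : a diagram in a disk with two ends on top (NW = position 0,
    NE = position 1) and two at the bottom (SW = position 0, SE = position 1). *)
Definition tangle22 (s : diagram) : bool := valid 2 s 2.

Definition vcomp (s1 s2 : diagram) : diagram := s1 ++ s2.

Definition vcomp_n (T : nat -> diagram) (n : nat) : diagram :=
  flatten [seq T i | i <- iota 0 n.+1].

Definition shift_piece (p : piece) : piece :=
  match p with
  | Cross i b => Cross i.+1 b
  | Birth i => Birth i.+1
  | Death i => Death i.+1
  end.

(** Denominator D(T): NW joined to SW by an arc on the left, NE joined to SE
    by an arc on the right, outside the disk. *)
Definition denominator (s : diagram) : diagram :=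
  [:: Birth 0; Birth 2] ++ map shift_piece s ++ [:: Death 2; Death 0].

Definition piece_edge (k w : nat) (p : piece) (a b : nat * nat) : Prop :=
  match p with
  | Cross i _ =>
      (exists j, (j < w)%N /\ j <> i /\ j <> i.+1 /\ a = (k, j) /\ b = (k.+1, j))
      \/ (a = (k, i) /\ b = (k.+1, i.+1))
      \/ (a = (k, i.+1) /\ b = (k.+1, i))
  | Birth i =>
      (exists j, (j < i)%N /\ a = (k, j) /\ b = (k.+1, j))
      \/ (exists j, (i <= j < w)%N /\ a = (k, j) /\ b = (k.+1, j.+2))
      \/ (a = (k.+1, i) /\ b = (k.+1, i.+1))
  | Death i =>
      (exists j, (j < i)%N /\ a = (k, j) /\ b = (k.+1, j))
      \/ (exists j, (i <= j)%N /\ (j.+2 < w)%N /\ a = (k, j.+2) /\ b = (k.+1, j))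
      \/ (a = (k, i) /\ b = (k, i.+1))
  end.

Definition dedge (w0 : nat) (s : diagram) (a b : nat * nat) : Prop :=
  exists k, (k < size s)%N /\
    piece_edge k (wid w0 s k) (nth (Birth 0) s k) a b.

(** A closed diagram (0 -> 0) is a knot diagram iff it has exactly one
    component, i.e. its underlying curve is nonempty and connected. *)
Definition is_knot (s : diagram) : Prop :=
  valid 0 s 0 /\
  exists a, point_ok 0 s a /\
    forall b, point_ok 0 s b -> clos_refl_sym_trans _ (dedge 0 s) a b.

(** * Representations of diagrams

   [rho k i] is the value rho(a) of the arc a through the point i of level k,
   directed downwards.  Reversing direction inverts the value (so the arc
   through a point is directed upwards has value (rho k i)^-1).  At a crossing
   with overarc a, incoming underarc b and outgoing underarc c (Wirtinger
   orientation) rho(c) = rho(a) rho(b) rho(a)^-1. *)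
Definition level := nat -> M2.

Definition piece_rep (w : nat) (p : piece) (x y : level) : Prop :=
  match p with
  | Cross i b =>
      (forall j, (j < w)%N -> j <> i -> j <> i.+1 -> y j = x j) /\
      (if b then y i.+1 = x i /\ y i = x i *m x i.+1 *m invmx (x i)
       else y i = x i.+1 /\ y i.+1 = invmx (x i.+1) *m x i *m x i.+1)
  | Birth i =>
      (forall j, (j < i)%N -> y j = x j) /\
      (forall j, (i <= j < w)%N -> y j.+2 = x j) /\
      y i.+1 = invmx (y i)
  | Death i =>
      (forall j, (j < i)%N -> y j = x j) /\
      (forall j, (i <= j)%N -> (j.+2 < w)%N -> y j = x j.+2) /\
      x i.+1 = invmx (x i)
  end.

Definition is_rep (w0 : nat) (s : diagram) (rho : nat -> level) : Prop :=
  (forall q, point_ok w0 s q -> inSL2 (rho q.1 q.2)) /\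
  (forall k, (k < size s)%N ->
     piece_rep (wid w0 s k) (nth (Birth 0) s k) (rho k) (rho k.+1)).

Definition in_Rt (t : C) (s : diagram) (rho : nat -> level) : Prop :=
  is_rep 2 s rho /\ forall q, point_ok 2 s q -> inGt t (rho q.1 q.2).

(** the arcs at the four ends, directed outward *)
Definition rho_nw (s : diagram) (rho : nat -> level) : M2 := invmx (rho 0%N 0%N).
Definition rho_ne (s : diagram) (rho : nat -> level) : M2 := invmx (rho 0%N 1%N).
Definition rho_sw (s : diagram) (rho : nat -> level) : M2 := rho (size s) 0%N.
Definition rho_se (s : diagram) (rho : nat -> level) : M2 := rho (size s) 1%N.

Definition g_rho (s : diagram) (rho : nat -> level) : M2 :=
  rho_nw s rho *m rho_ne s rho.

Definition tr_v (s : diagram) (rho : nat -> level) : C :=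
  \tr (rho_sw s rho *m rho_nw s rho).

(** * The knot group, characters and X^irr(K)

   Elements of pi(K) are represented by words in the Wirtinger generators,
   i.e. in the (downward directed) arcs through the points of the diagram;
   a letter (q, true) stands for the inverse of the generator at q.  Letters
   not naming a point of the diagram are ignored. *)
Definition word := seq ((nat * nat) * bool).

Definition eval_word (s : diagram) (rho : nat -> level) (u : word) : M2 :=
  foldr (fun l acc =>
           let: (q, inv) := l in
           if ((q.1 <= size s) && (q.2 < wid 0 s q.1))%N then
             (if inv then invmx (rho q.1 q.2) else rho q.1 q.2) *m acc
           else acc) 1%:M u.

Definition irreducible_rep (s : diagram) (rho : nat -> level) : Prop :=
  ~ exists v : 'cV[C]_2, v <> 0 /\
      forall u : word, exists lam : C, eval_word s rho u *m v = lam *: v.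

Definition character (s : diagram) (rho : nat -> level) : word -> C :=
  fun u => \tr (eval_word s rho u).

Definition charset := (word -> C) -> Prop.

Definition Xirr (s : diagram) : charset :=
  fun chi => exists rho, is_rep 0 s rho /\ irreducible_rep s rho /\
                         chi = character s rho.

(** regular functions on the character variety: polynomials in finitely
    many trace functions chi |-> chi(g) *)
Definition trace_poly := {m : nat & (mpoly.mpoly m C * ('I_m -> word))%type}.

Definition eval_tp (f : trace_poly) (chi : word -> C) : C :=
  mpoly.meval (fun i => chi ((projT2 f).2 i)) (projT2 f).1.

Definition zclosed (X Z : charset) : Prop :=
  exists S : trace_poly -> Prop,
    forall chi, Z chi <-> (X chi /\ forall f, S f -> eval_tp f chi = 0).

Definition irreducible_closed (X Z : charset) : Prop :=
  [/\ zclosed X Z, exists chi, Z chi &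
      forall Z1 Z2, zclosed X Z1 -> zclosed X Z2 ->
        (forall chi, Z chi -> Z1 chi \/ Z2 chi) ->
        (forall chi, Z chi -> Z1 chi) \/ (forall chi, Z chi -> Z2 chi)].

Definition strict_subset (A B : charset) : Prop :=
  (forall chi, A chi -> B chi) /\ exists chi, B chi /\ ~ A chi.

Definition dim_ge (X : charset) (d : nat) : Prop :=
  exists Z : nat -> charset,
    (forall k, (k <= d)%N -> irreducible_closed X (Z k)) /\
    (forall k, (k < d)%N -> strict_subset (Z k) (Z k.+1)).

(* Main.v *)
(** The product of the arcs met by a horizontal level is constant, so
    [g_rho = 1] makes the two top arcs of [T_i] mutually inverse, and likewise
    the two bottom arcs: [T_i] only sees its top-left and bottom-left values
    [a_i], [b_i].  Representations of the denominator with these restrictions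
    to the tangles are therefore the closed polygons [x_0, ..., x_n] in [G(t)]
    whose edges [(x_i, x_(i+1))] are conjugate to [(a_i, b_i)].  For [1 <= i] the
    trace condition says that [a_i, b_i] have no common eigenvector, so the edge
    is prescribed by the single number [tr (b_i a_i^-1)].  Hence the diagonals
    [tr (x_i x_1^-1)] of the fan at [x_1] can be prescribed almost freely, one
    triangle at a time.

    The dependence of the given representations on [t] is arbitrary, so the
    dimension is bounded without parametrizing families.  If trace functions
    [h_1, ..., h_d] successively take infinitely many values on the character
    set, then by induction the infinitely many slices [h_1 = c] contain chains of
    length [d - 1].  By Hilbert's basis theorem two of their top members lie in a
    common irreducible closed set, which is strictly larger. *)

Require Import Defs.
From mathcomp Require Import all_boot all_algebra.
From mathcomp Require Import complex Rstruct.
From mathcomp Require Import mpoly ring zify.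
From Stdlib Require Import Classical ClassicalEpsilon FunctionalExtensionality.
Import GRing.Theory Num.Theory.
Local Open Scope ring_scope.

(** * Hilbert's basis theorem *)

(** The ideal generated by [l], with the coefficients peeled off one generator at a time instead of
    being collected in a family. *)
Fixpoint ideal_span {R : comNzRingType} (l : seq R) (x : R) : Prop :=
  if l is a :: l' then exists c, ideal_span l' (x - c * a) else x = 0.

Lemma ideal_spanD {R : comNzRingType} (l : seq R) x y :
  ideal_span l x -> ideal_span l y -> ideal_span l (x + y).
Proof.
elim: l x y => [|a l IH] x y /=; first by move=> -> ->; rewrite addr0.
case=> c hc [d hd]; exists (c + d).
by rewrite mulrDl opprD addrACA; apply: IH.
Qed.

Lemma ideal_spanM {R : comNzRingType} (l : seq R) r x :
  ideal_span l x -> ideal_span l (r * x).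
Proof.
elim: l x => [|a l IH] x /=; first by move=> ->; rewrite mulr0.
by case=> c /IH; rewrite mulrBr mulrA; exists (r * c).
Qed.

Lemma ideal_span0 {R : comNzRingType} (l : seq R) : ideal_span l 0.
Proof. by elim: l => //= a l IH; exists 0; rewrite mul0r subr0. Qed.

Lemma ideal_span_mem {R : comNzRingType} (l : seq R) x :
  x \in l -> ideal_span l x.
Proof.
elim: l => //= a l IH; rewrite inE => /predU1P[->|/IH h].
  by exists 1; rewrite mul1r subrr; apply: ideal_span0.
by exists 0; rewrite mul0r subr0.
Qed.

Lemma ideal_span_ind {R : comNzRingType} (P : R -> Prop) (l : seq R) x :
  P 0 -> (forall c a y, a \in l -> P y -> P (y + c * a)) -> ideal_span l x -> P x.
Proof.
move=> P0; elim: l x => [|a l IH] x Pl /=; first by move=> ->.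
case=> c h; rewrite -(subrK (c * a) x); apply: (Pl); first exact: mem_head.
by apply: IH h => d b y bl; apply: Pl; rewrite inE bl orbT.
Qed.

Lemma ideal_span_sub {R : comNzRingType} (l l' : seq R) x :
  (forall y, y \in l -> ideal_span l' y) -> ideal_span l x -> ideal_span l' x.
Proof.
move=> h; apply: ideal_span_ind; first exact: ideal_span0.
by move=> c a y al hy; apply: ideal_spanD hy _; apply/ideal_spanM/h.
Qed.

Lemma mem_mkseq {T : eqType} (f : nat -> T) k y :
  reflect (exists2 i, (i < k)%N & y = f i) (y \in mkseq f k).
Proof.
by apply: (iffP mapP) => -[i hi ->]; exists i; rewrite // mem_iota in hi *.
Qed.

(** The ascending chain condition for sequences: no sequence has every term outside the ideal
    generated by its predecessors. *)
Definition noeth (R : comNzRingType) : Prop :=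
  forall f : nat -> R, exists k, ideal_span (mkseq f k) (f k).

Lemma noeth_field (F : fieldType) : noeth F.
Proof.
move=> f; have [f0|f0] := eqVneq (f 0%N) 0; first by exists 0%N.
by exists 1%N; rewrite /=; exists (f 1%N / f 0%N); rewrite mulfVK ?subrr.
Qed.

(** Cancellation of the leading term: the generators are multiplied by powers of ['X] up to the
    degree of [p], then combined with the coefficients that express [lead_coef p]. *)
Lemma ideal_span_lead {R : comNzRingType} (G : seq {poly R}) (p : {poly R}) :
  (forall q, q \in G -> (size q <= size p)%N) -> p != 0 ->
  ideal_span (map lead_coef G) (lead_coef p) ->
  exists2 q, ideal_span G q & (size (p - q)%R < size p)%N.
Proof.
move=> Gp p0 h.
(* For the induction, the leading coefficient is replaced by the coefficient in the top degree of
   [p], since partial combinations may vanish there. *)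
have hq c : ideal_span (map lead_coef G) c ->
    exists2 q : {poly R}, ideal_span G q & (size q <= size p)%N /\ q`_(size p).-1 = c.
  apply: (ideal_span_ind (fun c => exists2 q : {poly R}, ideal_span G q &
    (size q <= size p)%N /\ q`_(size p).-1 = c)).
    by exists 0; rewrite ?size_poly0 ?coef0 //; apply: ideal_span0.
  move=> d _ y /mapP[g gG ->] [q qG [sq cq]].
  have sg := Gp _ gG.
  exists (q + d%:P * 'X^(size p - size g) * g).
    by apply: ideal_spanD => //; apply/ideal_spanM/ideal_span_mem.
  have pp : (0 < size p)%N by rewrite size_poly_gt0.
  split.
    apply/leq_sizeP => j hj; rewrite coefD -mulrA coefCM coefXnM.
    rewrite (nth_default _ (leq_trans sq hj)) add0r.
    case: ltnP => hj2; first by rewrite mulr0.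
    by rewrite nth_default ?mulr0 // leq_subRL // subnK.
  rewrite coefD cq -mulrA coefCM coefXnM /lead_coef.
  have [g0|g0] := posnP (size g).
    move: g0 => /eqP; rewrite size_poly_eq0 => /eqP ->.
    by rewrite !coef0 if_same.
  case: ltnP => hj; first by exfalso; lia.
  by congr (_ + d * _`_ _); lia.
have [q qG [sq cq]] := hq _ h; exists q => //.
have pp : (0 < size p)%N by rewrite size_poly_gt0.
rewrite -(prednK pp) ltnS; apply/leq_sizeP => j hj; rewrite coefB.
move: hj; rewrite leq_eqVlt => /predU1P[<-|hj]; first by rewrite cq /lead_coef subrr.
by rewrite prednK // in hj; rewrite !nth_default ?subrr // (leq_trans sq).
Qed.

(* A non-finitely generated ideal yields a sequence of elements, each of least
   degree outside the ideal of its predecessors; their leading coefficients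
   then contradict the hypothesis on the base ring. *)
Lemma noeth_poly (R : comNzRingType) : noeth R -> noeth {poly R}.
Proof.
move=> hR f; apply: NNPP => hf.
pose I (p : {poly R}) := exists k, ideal_span (mkseq f k) p.
have Imono k m p : (k <= m)%N -> ideal_span (mkseq f k) p -> ideal_span (mkseq f m) p.
  move=> km; apply: ideal_span_sub => y /mem_mkseq[i ik ->].
  by apply/ideal_span_mem/mem_mkseq; exists i => //; apply: leq_trans km.
have next (l : seq {poly R}) : (forall q, q \in l -> I q) ->
    exists p, [/\ I p, ~ ideal_span l p &
      forall q, I q -> ~ ideal_span l q -> (size p <= size q)%N].
  move=> lI.
  have [k hk] : exists k, forall q, q \in l -> ideal_span (mkseq f k) q.
    elim: l lI => [|a l IH] lI; first by exists 0%N.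
    have [|k hk] := IH; first by move=> q ql; apply: lI; rewrite inE ql orbT.
    have [m hm] := lI a (mem_head _ _); exists (maxn k m) => q.
    rewrite inE => /predU1P[->|/hk]; first by apply: Imono hm; rewrite leq_maxr.
    by apply: Imono; rewrite leq_maxl.
  have : exists n, exists p, [/\ I p, ~ ideal_span l p & size p = n].
    exists (size (f k)), (f k); split=> //.
      by exists k.+1; apply/ideal_span_mem/mem_mkseq; exists k.
    by move=> h; apply: hf; exists k; apply: ideal_span_sub h.
  case=> n; elim/ltn_ind: n => n IH [p [pI pl ps]].
  have [[q [qI ql qs]]|no] :=
    classic (exists q, [/\ I q, ~ ideal_span l q & (size q < n)%N]).
    by apply: (IH _ qs); exists q.
  exists p; split=> // q qI ql; rewrite ps leqNgt; apply/negP => qs.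
  by apply: no; exists q.
pose Q (l : seq {poly R}) (p : {poly R}) := [/\ I p, ~ ideal_span l p &
  forall q, I q -> ~ ideal_span l q -> (size p <= size q)%N].
pose nx (l : seq {poly R}) : {poly R} := epsilon (inhabits 0) (Q l).
have nxP (l : seq {poly R}) : (forall q, q \in l -> I q) -> Q l (nx l).
  by move=> /next h; apply: epsilon_spec.
(* [hist k] lists the first [k] chosen polynomials, so that each choice can depend on all earlier
   ones. *)
pose hist := fix hist k := if k is k'.+1 then rcons (hist k') (nx (hist k')) else [::].
pose G k := nx (hist k).
have histE k : hist k = mkseq G k.
  elim: k => // k IH; rewrite /mkseq -addn1 iotaD map_cat cats1 /= add0n addn1 /=.
  by rewrite -/(G k) {1}IH.
have histI k q : q \in hist k -> I q.
  elim: k q => //= k IH q; rewrite mem_rcons inE => /predU1P[->|/IH //].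
  by have [] := nxP _ IH.
have GP k : Q (hist k) (G k) by apply/nxP/histI.
have [k hk] := hR (fun k => lead_coef (G k)).
have [GI Gn Gm] := GP k.
have [|||q ql qs] := @ideal_span_lead _ (hist k) (G k) _ _ _.
- move=> q; rewrite histE => /mem_mkseq[i ik ->].
  have [_ _ m] := GP i; apply: m GI _ => h; apply: Gn.
  apply: ideal_span_sub h => y; rewrite !histE => /mem_mkseq[j ji ->].
  by apply/ideal_span_mem/mem_mkseq; exists j => //; apply: ltn_trans ik.
- by apply/eqP => G0; apply: Gn; rewrite G0; apply: ideal_span0.
- by rewrite histE /mkseq -map_comp.
(* [G k - q] has smaller degree than [G k]; by minimality it lies in the span of [hist k], and then
   so does [G k]. *)
have Iq : I (G k - q).
  have [m hm] := GI.
  have [m' hm'] : I q.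
    apply: ideal_span_ind ql; first by exists 0%N.
    move=> c a y /histI[m1 h1] [m2 h2]; exists (maxn m1 m2); apply: ideal_spanD.
      by apply: Imono h2; rewrite leq_maxr.
    by apply/ideal_spanM; apply: Imono h1; rewrite leq_maxl.
  exists (maxn m m'); apply: ideal_spanD; first by apply: Imono hm; rewrite leq_maxl.
  by rewrite -mulN1r; apply/ideal_spanM; apply: Imono hm'; rewrite leq_maxr.
have := Gm _ Iq; rewrite leqNgt qs => /(_ _)/negP; apply => // h.
by apply: Gn; rewrite -(subrK q (G k)); apply: ideal_spanD.
Qed.

(** * The Zariski topology of a character set *)

(** The ring is an iterated polynomial ring over [K] with one variable for each entry of [L];
    evaluation at [o] sends the variable of [x] to [h x o]. *)
Lemma noeth_functions (Om : Type) (K : fieldType) (T : eqType) (L : seq T)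
    (h : T -> Om -> K) :
  exists (R : comNzRingType) (ev : Om -> {rmorphism R -> K}),
    [/\ noeth R, forall c, exists r, forall o, ev o r = c &
      forall x, x \in L -> exists r, forall o, ev o r = h x o].
Proof.
elim: L => [|a L [R [ev [nR evC evL]]]].
  by exists K, (fun=> idfun); split=> [|c|//]; [exact: noeth_field|exists c].
pose ev' o : {rmorphism {poly R} -> K} :=
  GRing.RMorphism.clone _ _ (horner_eval (h a o) \o map_poly (ev o)) _.
have ev'C o r : ev' o r%:P = ev o r.
  by rewrite /= /horner_eval map_polyC hornerC.
exists {poly R}, ev'; split; first exact: noeth_poly.
  by move=> c; have [r hr] := evC c; exists r%:P => o; rewrite ev'C.
move=> x; rewrite inE => /predU1P[->|/evL [r hr]].
  by exists 'X => o; rewrite /= /horner_eval map_polyX hornerX.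
by exists r%:P => o; rewrite ev'C.
Qed.

(** The descending chain condition on closed sets, told by witnesses: it is impossible that each
    [f k] is nonzero at [chi k] but vanishes at all later characters. *)
Definition dcc (X : charset) : Prop :=
  forall (chi : nat -> word -> C) (f : nat -> trace_poly),
    (forall k, X (chi k)) ->
    (forall i k, (i < k)%N -> eval_tp (f i) (chi k) = 0) ->
    exists k, eval_tp (f k) (chi k) = 0.

Lemma sig_choice {A B : Type} (P : A -> B -> Prop) :
  (forall a, exists b, P a b) -> exists f : A -> B, forall a, P a (f a).
Proof.
move=> h; exists (fun a => proj1_sig (constructive_indefinite_description _ (h a))).
by move=> a; case: constructive_indefinite_description.
Qed.

Lemma sum_ord2 (R : nmodType) (F : 'I_2 -> R) : \sum_(i < 2) F i = F 0 + F 1.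
Proof.
rewrite big_ord_recl big_ord1; have -> : lift ord0 ord0 = 1 :> 'I_2 by apply/val_inj.
by have -> : ord0 = 0 :> 'I_2 by apply/val_inj.
Qed.

(* Along a sequence of representations, all trace functions lie in a ring
   generated by the entries of finitely many matrices. *)
Lemma dcc_Xirr s : dcc (Xirr s).
Proof.
move=> chi f /sig_choice[rho hrho] hf.
pose L : seq (nat * nat) :=
  [seq (k, j) | k <- iota 0 (size s).+1, j <- iota 0 (wid 0 s k)].
(* Entries of inverses are generators of their own, so every letter of a word has its entries among
   the generators. *)
pose h (x : (nat * nat) * (bool * 'I_2 * 'I_2)) (k : nat) : C :=
  let: (q, (b, i, j)) := x in
  (if b then invmx (rho k q.1 q.2) else rho k q.1 q.2) i j.
have [R [ev [nR evC evL]]] := @noeth_functions nat C _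
  [seq (q, e) | q <- L, e <- enum {: bool * 'I_2 * 'I_2}] h.
pose reg (g : nat -> C) := exists r, forall k, ev k r = g k.
have regD g1 g2 : reg g1 -> reg g2 -> reg (fun k => g1 k + g2 k).
  by case=> r1 h1 [r2 h2]; exists (r1 + r2) => k; rewrite rmorphD h1 h2.
have regM g1 g2 : reg g1 -> reg g2 -> reg (fun k => g1 k * g2 k).
  by case=> r1 h1 [r2 h2]; exists (r1 * r2) => k; rewrite rmorphM h1 h2.
have regE g1 g2 : g1 =1 g2 -> reg g1 -> reg g2.
  by move=> g12 [r hr]; exists r => k; rewrite hr.
have regW u i j : reg (fun k => eval_word s (rho k) u i j).
  elim: u i j => [|[q b] u IH] i j; first exact: evC.
  apply: (regE (fun k => (if ((q.1 <= size s) && (q.2 < wid 0 s q.1))%N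
    then (if b then invmx (rho k q.1 q.2) else rho k q.1 q.2) *m eval_word s (rho k) u
    else eval_word s (rho k) u) i j)); first by [].
  case: (boolP ((q.1 <= size s) && (q.2 < wid 0 s q.1))%N) => [/andP[q1 q2]|_];
    last exact: IH.
  have e i' j' : reg (fun k => h (q, (b, i', j')) k).
    apply/evL/allpairs_f; last by rewrite mem_enum.
    apply/allpairsPdep; exists q.1, q.2; rewrite !mem_iota ltnS; split=> //.
    by case: (q) => ? ?.
  have hD := regD _ _ (regM _ _ (e i 0) (IH 0 j)) (regM _ _ (e i 1) (IH 1 j)).
  refine (regE _ _ _ hD) => k.
  by rewrite mxE sum_ord2.
have regC u : reg (fun k => chi k u).
  apply: (regE _ _ _ (regD _ _ (regW u 0 0) (regW u 1 1))) => k; have [_ [_ ->]] := hrho k.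
  by rewrite /character /mxtrace sum_ord2.
have regf i : reg (fun k => eval_tp (f i) (chi k)).
  case: (f i) => m [p u]; rewrite /eval_tp /=.
  apply: (regE (fun k => \sum_(a <- mpoly.msupp p) mpoly.mcoeff a p *
    \prod_(i0 < m) chi k (u i0) ^+ mpoly.fun_of_multinom a i0)).
    by move=> k; rewrite mpoly.mevalE.
  elim: (mpoly.msupp p) => [|a l IH].
    by have [r hr] := evC 0; exists r => k; rewrite hr big_nil.
  have hp : reg (fun k => \prod_(i0 < m) chi k (u i0) ^+ mpoly.fun_of_multinom a i0).
    rewrite -[index_enum _]enumT; elim: (enum _) => [|x l' IH'].
      by have [r hr] := evC 1; exists r => k; rewrite hr big_nil.
    have hx n : reg (fun k => chi k (u x) ^+ n).
      elim: n => [|n IHn]; first exact: evC.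
      by apply: (regE _ _ _ (regM _ _ (regC (u x)) IHn)) => k; rewrite exprS.
    by apply: (regE _ _ _ (regM _ _ (hx (mpoly.fun_of_multinom a x)) IH')) => k; rewrite big_cons.
  have [c hc] := evC (mpoly.mcoeff a p).
  have hcp := regM _ _ (ex_intro _ c hc) hp.
  by apply: (regE _ _ _ (regD _ _ hcp IH)) => k; rewrite big_cons.
have [r hr] := sig_choice _ regf.
(* The functions [f i] with [i < k] vanish at [chi k], hence so does everything in the ideal of
   their representatives, which contains that of [f k]. *)
have [k hk] := nR r; exists k; rewrite -hr.
apply: (ideal_span_ind (fun x => ev k x = 0)) hk; first exact: rmorph0.
move=> c a y /mem_mkseq[i ik ->] hy.
by rewrite rmorphD rmorphM hy hr hf // mulr0 addr0.
Qed.

(** Noetherian induction. A counterexample would start an infinite strictly descending chain of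
    closed sets; a character lost at each step and a function that detects the loss contradict
    [dcc]. *)
Lemma closed_ind (X : charset) (P : charset -> Prop) : dcc X ->
  (forall Z, zclosed X Z ->
     (forall Z', zclosed X Z' -> strict_subset Z' Z -> P Z') -> P Z) ->
  forall Z, zclosed X Z -> P Z.
Proof.
move=> dX step Z0 cZ0; apply: NNPP => nP.
pose bad := {Z : charset | zclosed X Z /\ ~ P Z}.
have [nx nxP] : exists nx : bad -> bad, forall Z, strict_subset (sval (nx Z)) (sval Z).
  apply: (@sig_choice bad bad (fun Z Z' => strict_subset (sval Z') (sval Z))).
  case=> Z [cZ nZ] /=; apply: NNPP => no; apply: nZ; apply: step => // Z' cZ' sZ'.
  by apply: NNPP => nZ'; apply: no; exists (exist _ Z' (conj cZ' nZ')).
pose Zs k : charset := sval (iter k nx (exist _ Z0 (conj cZ0 nP))).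
have cZs k : zclosed X (Zs k) by rewrite /Zs; case: (iter _ _ _) => ? [].
have sub i j chi : (i <= j)%N -> Zs j chi -> Zs i chi.
  move=> ij; rewrite -(subnK ij); elim: (j - i)%N => // m IH h; apply: IH.
  by have [s _] := nxP (iter (m + i) nx (exist _ Z0 (conj cZ0 nP))); apply: s.
have wit k : exists cf : (word -> C) * trace_poly,
    [/\ Zs k cf.1, eval_tp cf.2 cf.1 <> 0 &
      forall chi, Zs k.+1 chi -> eval_tp cf.2 chi = 0].
  have [_ [chi [h1 h2]]] := nxP (iter k nx (exist _ Z0 (conj cZ0 nP))).
  have [S hS] := cZs k.+1; have [S' hS'] := cZs k.
  apply: NNPP => no; apply: h2; apply/hS; split; first by have [] := (hS' chi).1 h1.
  move=> f Sf; apply: NNPP => nf; apply: no; exists (chi, f); split=> //= chi' /hS[_].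
  exact.
have [cf hcf] := sig_choice _ wit.
have [||k] := dX (fun k => (cf k).1) (fun k => (cf k).2).
- by move=> k; have [h _ _] := hcf k; have [S hS] := cZs k; have [] := (hS _).1 h.
- move=> i k ik; have [h _ _] := hcf k; have [_ _ ] := hcf i; apply.
  exact: sub h.
by have [_] := hcf k.
Qed.

(** * Infinite families of irreducible closed sets *)

Definition infinitely_many (P : C -> Prop) : Prop :=
  forall F : seq C, exists2 c, c \notin F & P c.

Lemma infinitely_manyW (P Q : C -> Prop) :
  (forall c, P c -> Q c) -> infinitely_many P -> infinitely_many Q.
Proof. by move=> PQ h F; have [c cF /PQ] := h F; exists c. Qed.

Lemma infinitely_manyU (P Q : C -> Prop) :
  infinitely_many (fun c => P c \/ Q c) -> infinitely_many P \/ infinitely_many Q.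
Proof.
move=> h; apply: NNPP => /not_or_and[/not_all_ex_not[F1 n1] /not_all_ex_not[F2 n2]].
have [c] := h (F1 ++ F2); rewrite mem_cat negb_or => /andP[c1 c2] [hP|hQ].
  by apply: n1; exists c.
by apply: n2; exists c.
Qed.

Definition meet (A B : charset) : charset := fun chi => A chi /\ B chi.

Lemma zclosedI X A B : zclosed X A -> zclosed X B -> zclosed X (meet A B).
Proof.
move=> [S hS] [S' hS']; exists (fun f => S f \/ S' f) => chi; split.
  move=> [/hS[Xc hA] /hS'[_ hB]]; split=> // f [].
    exact: hA.
  exact: hB.
by move=> [Xc h]; split; [apply/hS|apply/hS']; split=> // f hf; apply: h; [left|right].
Qed.

Lemma zclosed_refl X : zclosed X X.
Proof. by exists (fun=> False) => chi; split=> [|[]]. Qed.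

(* A weak form of "finitely many irreducible components". *)
Lemma irreducible_pigeonhole (X : charset) (W : C -> charset) (P : C -> Prop) :
  dcc X -> (forall c, P c -> irreducible_closed X (W c)) -> infinitely_many P ->
  exists2 Y, irreducible_closed X Y &
    infinitely_many (fun c => P c /\ forall chi, W c chi -> Y chi).
Proof.
move=> dX irr infP.
pose inside Z c := P c /\ forall chi, W c chi -> Z chi.
suff: forall Z, zclosed X Z -> infinitely_many (inside Z) ->
    exists2 Y, irreducible_closed X Y & infinitely_many (inside Y).
  apply; first exact: zclosed_refl.
  apply: infinitely_manyW infP => c Pc; split=> // chi.
  by have [[S hS] _ _] := irr _ Pc; case/hS.
apply: (closed_ind _ _ dX) => Z cZ IH infZ.
have [irrZ|nirrZ] := classic (irreducible_closed X Z); first by exists Z.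
have [Z1 [Z2 [c1 c2 Zsub n1 n2]]] : exists Z1 Z2, [/\ zclosed X Z1, zclosed X Z2,
    forall chi, Z chi -> Z1 chi \/ Z2 chi,
    ~ (forall chi, Z chi -> Z1 chi) & ~ (forall chi, Z chi -> Z2 chi)].
  apply: NNPP => no; apply: nirrZ; split=> //.
    have [c _ [Pc sub]] := infZ [::]; have [_ [chi hchi] _] := irr _ Pc.
    by exists chi; apply: sub.
  move=> Z1 Z2 c1 c2 h; apply: NNPP => /not_or_and[n1 n2].
  by apply: no; exists Z1, Z2.
have smaller Z' : zclosed X Z' -> ~ (forall chi, Z chi -> Z' chi) ->
    infinitely_many (inside (meet Z Z')) ->
    exists2 Y, irreducible_closed X Y & infinitely_many (inside Y).
  move=> cZ' nZ'; apply: IH; first exact: zclosedI.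
  split=> [chi []//|]; apply: NNPP => no; apply: nZ' => chi hZ.
  by apply: NNPP => nZ'; apply: no; exists chi; split=> // -[].
(* Being irreducible, each [W c] inside [Z] lies in [Z1] or in [Z2], so one of the two contains
   infinitely many of them. *)
have [||] := @infinitely_manyU (inside (meet Z Z1)) (inside (meet Z Z2)).
- apply: infinitely_manyW infZ => c [Pc sub].
  have [_ _] := irr _ Pc; case/(_ _ _ c1 c2) => [chi /sub /Zsub //|h|h].
    by left; split=> // chi hc; split; [apply: sub|apply: h].
  by right; split=> // chi hc; split; [apply: sub|apply: h].
- exact: smaller.
exact: smaller.
Qed.

(** * Level sets and chains of closed sets *)

Definition level_set (X : charset) (w : word) (c : C) : charset :=
  fun chi => X chi /\ chi w = c.

Definition word_sub (w : word) (c : C) : trace_poly :=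
  existT _ 1%N (mpoly.mpolyX C (mpoly.mnm1 ord0) - mpoly.mpolyC 1 c, fun=> w).

Lemma eval_word_sub w c chi : eval_tp (word_sub w c) chi = chi w - c.
Proof. by rewrite /eval_tp /= mpoly.mevalB mpoly.mevalXU mpoly.mevalC. Qed.

Lemma zclosed_level X w c : zclosed X (level_set X w c).
Proof.
exists (eq (word_sub w c)) => chi; split=> -[Xc h]; split=> //.
  by move=> _ <-; rewrite eval_word_sub h subrr.
by apply/eqP; rewrite -subr_eq0 -eval_word_sub h.
Qed.

Lemma zclosed_trans X Y Z : zclosed X Y -> zclosed Y Z -> zclosed X Z.
Proof.
move=> [S hS] [S' hS']; exists (fun f => S f \/ S' f) => chi; split.
  by move=> /hS'[/hS[Xc h] h']; split=> // f []; [apply: h|apply: h'].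
move=> [Xc h]; apply/hS'; split; first by apply/hS; split=> // f hf; apply: h; left.
by move=> f hf; apply: h; right.
Qed.

Lemma zclosed_restrict X Y Z : (forall chi, Y chi -> X chi) ->
  zclosed X Z -> zclosed Y (meet Y Z).
Proof.
move=> YX [S hS]; exists S => chi; split; first by move=> [Yc /hS[]].
by move=> [Yc h]; split=> //; apply/hS; split=> //; apply: YX.
Qed.

(** Irreducibility does not depend on the ambient set: a cover by sets closed in [X] restricts to a
    cover by sets closed in [Y]. *)
Lemma irreducible_closed_trans X Y Z :
  zclosed X Y -> irreducible_closed Y Z -> irreducible_closed X Z.
Proof.
move=> cY [cZ neZ irr]; split=> //; first exact: zclosed_trans cZ.
have YX chi : Y chi -> X chi by case: cY => S hS /hS[].
have ZY chi : Z chi -> Y chi by case: cZ => S hS /hS[].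
move=> Z1 Z2 c1 c2 cov.
have [| | chi hc|h|h] := irr (meet Y Z1) (meet Y Z2).
- exact: zclosed_restrict c1.
- exact: zclosed_restrict c2.
- by have hY := ZY _ hc; have [h|h] := cov _ hc; [left|right].
- by left=> chi /h[].
by right=> chi /h[].
Qed.

Lemma dim_ge_nonempty X : (exists chi, X chi) -> dim_ge X 0.
Proof.
move=> [chi Xc]; exists (fun _ => eq chi); split=> // k _; split.
(* A character is cut out by all functions vanishing at it, because these include
   [word_sub w (chi w)] for every word [w]. *)
- exists (fun f => eval_tp f chi = 0) => chi'; split; first by move=> <-.
  move=> [Xc' h]; apply: functional_extensionality => w; apply/esym/eqP.
  by rewrite -subr_eq0 -eval_word_sub; apply/eqP/h; rewrite eval_word_sub subrr.
- by exists chi.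
move=> Z1 Z2 _ _ h; have [h1|h2] := h _ (erefl chi); first by left=> _ <-.
by right=> _ <-.
Qed.

(** The quantifiers are nested: the admissible values of a coordinate may depend on all earlier
    coordinates. Such a set of tuples is Zariski dense in affine [d]-space. *)
Fixpoint large (d : nat) (P : seq C -> Prop) : Prop :=
  if d is d'.+1 then infinitely_many (fun c => large d' (fun cs => P (c :: cs)))
  else P [::].

Lemma largeW d (P Q : seq C -> Prop) :
  (forall cs, size cs = d -> P cs -> Q cs) -> large d P -> large d Q.
Proof.
elim: d P Q => [|d IH] P Q PQ /=; first exact: PQ.
by apply: infinitely_manyW => c; apply: IH => cs hs; apply: PQ; rewrite /= hs.
Qed.

Lemma dcc_sub X Y : (forall chi, Y chi -> X chi) -> dcc X -> dcc Y.
Proof. by move=> YX dX chi f hchi; apply: dX => k; apply: YX. Qed.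

(** Induction over the words: [level_set X w c] inherits the hypothesis for the remaining words and
    so carries a chain, whose members are irreducible and closed in [X] too.
    [irreducible_pigeonhole] supplies one more set on top. *)
Lemma dim_ge_large X (ws : seq word) : dcc X ->
  large (size ws) (fun cs => exists2 chi, X chi & map chi ws = cs) ->
  dim_ge X (size ws).
Proof.
elim: ws X => [|w ws IH] X dX /=.
  by case=> chi Xc _; apply: dim_ge_nonempty; exists chi.
move=> hinf.
pose top c Z := exists Zs : nat -> charset, [/\ Zs (size ws) = Z,
  forall k, (k <= size ws)%N -> irreducible_closed (level_set X w c) (Zs k) &
  forall k, (k < size ws)%N -> strict_subset (Zs k) (Zs k.+1)].
have {hinf} hinf : infinitely_many (fun c => exists Z, top c Z).
  apply: infinitely_manyW hinf => c hc.
  have [||Zs [h1 h2]] := IH (level_set X w c).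
  - by apply: dcc_sub dX => chi [].
  - apply: largeW hc => cs _ [chi Xc [hw hws]].
    by exists chi.
  by exists (Zs (size ws)), Zs.
(* One top member is fixed for each [c], as the pigeonhole argument needs a function of [c]. *)
pose W c := epsilon (inhabits X) (top c).
have WP c : (exists Z, top c Z) -> top c (W c) by apply: epsilon_spec.
have irrW c : (exists Z, top c Z) -> irreducible_closed X (W c).
  move=> /WP[Zs [<- h _]]; apply: irreducible_closed_trans (h _ (leqnn _)).
  exact: zclosed_level.
have [Y irrY infY] := irreducible_pigeonhole X W _ dX irrW hinf.
(* The chain for [c] is kept. The second value [c'] only serves to show that [Y] is larger: a
   character in [W c'] has value [c'] at [w], so it is not in [W c]. *)
have [c _ [/WP[Zs [WE h1 h2]] sub]] := infY [::].
have [c' cc' [hc' sub']] := infY [:: c].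
exists (fun k => if (k <= size ws)%N then Zs k else Y); split=> k hk.
  case: ifP => // hk'; apply: irreducible_closed_trans (h1 _ hk').
  exact: zclosed_level.
rewrite ltnS in hk; rewrite hk; case: ltnP => hk'; first exact: h2.
have -> : k = size ws by apply/eqP; rewrite eqn_leq hk.
rewrite WE; split=> //.
have [Zs' [WE' h1' _]] := WP _ hc'.
have [_ [chi Wchi] _] := irrW _ hc'; exists chi; split; first exact: sub'.
move=> Wc; move: cc'; rewrite inE => /eqP; apply.
have [[S hS] _ _] := h1 _ (leqnn _); have [[S' hS'] _ _] := h1' _ (leqnn _).
rewrite WE in hS; rewrite WE' in hS'.
have [[_ <-] _] := (hS' _).1 Wchi.
by have [[_ <-] _] := (hS _).1 Wc.
Qed.

(** * Pairs of matrices in SL2 *)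

Definition mx2 (a b c d : C) : M2 :=
  \matrix_(i < 2, j < 2)
    (if i == 0 then (if j == 0 then a else b) else (if j == 0 then c else d)).

Lemma mx2_ind (P : M2 -> Prop) : (forall a b c d, P (mx2 a b c d)) -> forall A, P A.
Proof.
move=> h A; suff -> : A = mx2 (A 0 0) (A 0 1) (A 1 0) (A 1 1) by [].
apply/matrixP => i j; rewrite mxE.
by case: i => -[|[|//]] hi; case: j => -[|[|//]] hj; rewrite /=; congr (A _ _); apply/val_inj.
Qed.

Lemma mx2M a b c d a' b' c' d' : mx2 a b c d *m mx2 a' b' c' d' =
  mx2 (a * a' + b * c') (a * b' + b * d') (c * a' + d * c') (c * b' + d * d').
Proof.
apply/matrixP => i j; rewrite !mxE sum_ord2 !mxE /=.
by case: i => -[|[|//]] hi; case: j => -[|[|//]] hj.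
Qed.

Lemma mx2D a b c d a' b' c' d' :
  mx2 a b c d + mx2 a' b' c' d' = mx2 (a + a') (b + b') (c + c') (d + d').
Proof. by apply/matrixP => i j; rewrite !mxE; case: ifP => _; case: ifP. Qed.

Lemma mx2N a b c d : - mx2 a b c d = mx2 (- a) (- b) (- c) (- d).
Proof. by apply/matrixP => i j; rewrite !mxE; case: ifP => _; case: ifP. Qed.

Lemma mx2_scal a : a%:M = mx2 a 0 0 a.
Proof.
apply/matrixP => i j; rewrite !mxE.
by case: i => -[|[|//]] hi; case: j => -[|[|//]] hj.
Qed.

Lemma mx2_0 : (0 : M2) = mx2 0 0 0 0.
Proof. by apply/matrixP => i j; rewrite !mxE; case: ifP; case: ifP. Qed.

Lemma mx2Z k a b c d : k *: mx2 a b c d = mx2 (k * a) (k * b) (k * c) (k * d).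
Proof. by apply/matrixP => i j; rewrite !mxE; case: ifP; case: ifP. Qed.

Lemma mx2_det a b c d : \det (mx2 a b c d) = a * d - b * c.
Proof. 
rewrite (expand_det_row _ 0) sum_ord2 /cofactor !det_mx11 !mxE /=.
by rewrite expr0 expr1 mul1r mulN1r mulrN. Qed.

Lemma mx2_tr a b c d : \tr (mx2 a b c d) = a + d.
Proof. by rewrite /mxtrace sum_ord2 !mxE. Qed.

Lemma mx2_inj a b c d a' b' c' d' :
  mx2 a b c d = mx2 a' b' c' d' -> [/\ a = a', b = b', c = c' & d = d'].
Proof.
move=> /matrixP h.
by split; [move: (h 0 0)|move: (h 0 1)|move: (h 1 0)|move: (h 1 1)]; rewrite !mxE.
Qed.

Lemma invmx_SL2 a b c d : a * d - b * c = 1 -> invmx (mx2 a b c d) = mx2 d (- b) (- c) a.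
Proof.
move=> h; have u : mx2 a b c d \in unitmx by rewrite unitmxE mx2_det h unitr1.
rewrite -[RHS](mulKmx u) mx2M [X in invmx _ *m X](_ : _ = 1%:M) ?mulmx1 //.
by rewrite mx2_scal; congr mx2; rewrite -?h; ring.
Qed.

Lemma det_inv1 (x : M2) : \det x = 1 -> \det (invmx x) = 1.
Proof. by rewrite det_inv => ->; rewrite invr1. Qed.

Lemma unit_det1 (x : M2) : \det x = 1 -> x \in unitmx.
Proof. by rewrite unitmxE => ->; rewrite unitr1. Qed.

(** The additive commutator records two conditions at once: it is zero when the matrices commute,
    and its determinant is zero when they have a common eigenvector. *)
Definition comm (x y : M2) : M2 := x *m y - y *m x.

(* The classical [tr [x,y] - 2 = X^2 + Y^2 + Z^2 - X Y Z - 4] in disguise: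
   [det (xy - yx) = 2 - tr [x,y]] on SL2. *)
Lemma det_comm (t : C) (x y : M2) : \det x = 1 -> \det y = 1 -> \tr x = t -> \tr y = t ->
  \det (comm x y) = - ((\tr (y *m invmx x) - 2) * (\tr (y *m invmx x) - (t ^+ 2 - 2))).
Proof.
elim/mx2_ind: x => a b c d; elim/mx2_ind: y => e f g h.
rewrite !mx2_det !mx2_tr => h1 h2 h3 h4.
rewrite invmx_SL2 // /comm !mx2M mx2N mx2D mx2_det mx2_tr.
have -> : t ^+ 2 - 2 = (a + d) * (e + h) - (a * d - b * c) - (e * h - f * g).
  by rewrite h1 h2 h3 h4; ring.
set z := e * d + f * - c + (g * - b + h * a).
have -> : (z - 2) * (z - ((a + d) * (e + h) - (a * d - b * c) - (e * h - f * g))) =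
  z ^+ 2 - z * (a + d) * (e + h) + (a + d) * (a + d) + (e + h) * (e + h)
   - 4.
  rewrite h1 h2 h3 h4; ring.
(* Homogenization: the terms of lower degree are multiplied by determinants equal to 1, after which
   the claim is a polynomial identity in the entries. *)
have -> : (4 : C) = 4 * (a * d - b * c) * (e * h - f * g) by rewrite h1 h2; ring.
have -> : (a + d) * (a + d) = (a + d) * (a + d) * (e * h - f * g) by rewrite h2; ring.
have -> : (e + h) * (e + h) = (e + h) * (e + h) * (a * d - b * c) by rewrite h1; ring.
rewrite /z; ring.
Qed.

Lemma mxtraceJ (g x : M2) : g \in unitmx -> \tr (g *m x *m invmx g) = \tr x.
Proof. by move=> u; rewrite mxtrace_mulC mulmxA mulVmx // mul1mx. Qed.

Lemma det_conj (g x : M2) : g \in unitmx -> \det (g *m x *m invmx g) = \det x.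
Proof.
by move=> u; rewrite !det_mulmx mulrAC -det_mulmx mulmxV // det1 mul1r.
Qed.

Lemma mulmxJ (g x y : M2) : g \in unitmx ->
  g *m x *m invmx g *m (g *m y *m invmx g) = g *m (x *m y) *m invmx g.
Proof. by move=> u; rewrite !mulmxA mulmxKV. Qed.

Lemma invmxM2 (x y : M2) : x \in unitmx -> y \in unitmx ->
  invmx (x *m y) = invmx y *m invmx x.
Proof. exact: (@invrM M2). Qed.

Lemma invmxJ (g x : M2) : g \in unitmx -> x \in unitmx ->
  invmx (g *m x *m invmx g) = g *m invmx x *m invmx g.
Proof.
by move=> u v; rewrite !invmxM2 ?unitmx_mul ?unitmx_inv ?u // invmxK mulmxA.
Qed.

Lemma commJ (g x y : M2) : g \in unitmx ->
  comm (g *m x *m invmx g) (g *m y *m invmx g) = g *m comm x y *m invmx g.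
Proof. by move=> u; rewrite /comm !mulmxJ // mulmxBr mulmxBl. Qed.

(** * Normal forms and conjugacy of pairs *)

Definition conj_mx (g x : M2) : M2 := g *m x *m invmx g.

(** The shape of a pair in the basis [(v, y v)], for [v] an eigenvector of [x]: [x] becomes
    triangular and [y] the companion matrix of $X^2 - tX + 1$. *)
Definition nf_x (l s m : C) : M2 := mx2 l s 0 m.
Definition nf_y (t : C) : M2 := mx2 0 (- 1) 1 t.

Lemma SL2_eigenvector (x : M2) l m : \det x = 1 -> l * m = 1 -> \tr x = l + m ->
  exists2 v : 'cV[C]_2, v <> 0 & x *m v = l *: v.
Proof.
move=> dx lm tx.
(* [det0P] produces a row vector in the left kernel, hence the transposes. *)
have /det0P[v v0 hv] : \det (x - l%:M)^T == 0.
  rewrite det_tr; move: dx tx; elim/mx2_ind: x => a b c d.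
  rewrite mx2_scal mx2N mx2D !mx2_det mx2_tr => dx tx; apply/eqP.
  have -> : (a - l) * (d - l) - (b + - 0) * (c + - 0) = (a * d - b * c) - (a + d) * l + l * l by ring.
  by rewrite dx tx -lm; ring.
exists v^T; first by move/(congr1 trmx); rewrite trmxK trmx0; apply/eqP.
move/(congr1 trmx): hv; rewrite trmx_mul trmxK trmx0 mulmxBl mul_scalar_mx => /eqP.
by rewrite subr_eq0 => /eqP.
Qed.

Lemma colinear2 (v w : 'cV[C]_2) : v <> 0 ->
  v 0 0 * w 1 0 = w 0 0 * v 1 0 -> exists k, w = k *: v.
Proof.
move=> v0 e; have [p0|p0] := eqVneq (v 0 0) 0.
  have [q0|q0] := eqVneq (v 1 0) 0.
    case: v0; apply/matrixP => i j; rewrite ord1 mxE.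
    case: i => -[|[|//]] hi; [rewrite -[RHS]p0|rewrite -[RHS]q0]; congr (v _ _); exact/val_inj.
  exists (w 1 0 / v 1 0); apply/matrixP => i j; rewrite ord1 mxE.
  have w0 : w 0 0 = 0.
    by apply/eqP; move/eqP: e; rewrite p0 mul0r eq_sym mulf_eq0 (negPf q0) orbF.
  case: i => -[|[|//]] hi.
    have -> : Ordinal hi = 0 by apply/val_inj.
    by rewrite p0 w0 mulr0.
  have -> : Ordinal hi = 1 by apply/val_inj.
  by rewrite divfK.
exists (w 0 0 / v 0 0); apply/matrixP => i j; rewrite ord1 mxE.
case: i => -[|[|//]] hi.
  have -> : Ordinal hi = 0 by apply/val_inj.
  by rewrite divfK.
have -> : Ordinal hi = 1 by apply/val_inj.
by rewrite mulrAC -e mulrC mulKf.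
Qed.

Definition mx_cols (v w : 'cV[C]_2) : M2 := mx2 (v 0 0) (w 0 0) (v 1 0) (w 1 0).

Lemma mx_cols0 v w : mx_cols v w *m \col_(i < 2) (i == 0)%:R = v.
Proof.
apply/matrixP => i j; rewrite !mxE sum_ord2 !mxE /= ord1.
case: i => -[|[|//]] hi; rewrite /= mulr1 mulr0 addr0; congr (v _ _); exact/val_inj.
Qed.

Lemma mx_cols1 v w : mx_cols v w *m \col_(i < 2) (i == 1)%:R = w.
Proof.
apply/matrixP => i j; rewrite !mxE sum_ord2 !mxE /= ord1.
case: i => -[|[|//]] hi; rewrite /= mulr1 mulr0 add0r; congr (w _ _); exact/val_inj.
Qed.

Lemma mx_cols_unit v w : v <> 0 -> (forall k, w <> k *: v) -> mx_cols v w \in unitmx.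
Proof.
move=> v0 h; rewrite unitmxE mx2_det unitfE subr_eq0; apply/eqP => e.
by have [k /h] := colinear2 _ _ v0 e.
Qed.

Lemma mx_col0 (X : M2) i : (X *m \col_(i < 2) (i == 0)%:R) i 0 = X i 0.
Proof. by rewrite mxE sum_ord2 !mxE /= mulr1 mulr0 addr0. Qed.

Lemma conj_mxK (Q x : M2) : Q \in unitmx -> conj_mx Q (conj_mx (invmx Q) x) = x.
Proof. by move=> u; rewrite /conj_mx invmxK !mulmxA mulmxV // mul1mx mulmxK. Qed.

(* Conjugating by the basis (v, y v). *)
Lemma normal_form (x y : M2) (v : 'cV[C]_2) l m : \det x = 1 -> \det y = 1 ->
  \tr x = l + m -> v <> 0 -> x *m v = l *: v -> comm x y *m v <> 0 ->
  exists Q s, [/\ Q \in unitmx, x = conj_mx Q (nf_x l s m) &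
    y = conj_mx Q (nf_y (\tr y))].
Proof.
move=> dx dy tx v0 xv nv.
pose Q := mx_cols v (y *m v).
have Qu : Q \in unitmx.
  (* If [y v] were a multiple of [v], then [v] would be a common eigenvector and the commutator
     would kill it. *)
  apply: mx_cols_unit => // k hk; apply: nv.
  rewrite mulmxBl -!mulmxA xv hk -!scalemxAr xv hk !scalerA mulrC.
  by rewrite subrr.
pose X := conj_mx (invmx Q) x; pose Y := conj_mx (invmx Q) y.
have Qiu : invmx Q \in unitmx by rewrite unitmx_inv.
have Xc i : X i 0 = l * (i == 0)%:R.
  rewrite -mx_col0 /X /conj_mx invmxK -!mulmxA mx_cols0 xv -scalemxAr.
  by rewrite -{1}(mx_cols0 v (y *m v)) mulKmx // !mxE.
have Yc i : Y i 0 = (i == 1)%:R.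
  rewrite -mx_col0 /Y /conj_mx invmxK -!mulmxA mx_cols0.
  by rewrite -{1}(mx_cols1 v (y *m v)) mulKmx // !mxE.
have dX : \det X = 1 by rewrite det_conj.
have dY : \det Y = 1 by rewrite det_conj.
have tX : \tr X = l + m by rewrite mxtraceJ.
have tY : \tr Y = \tr y by rewrite mxtraceJ.
exists Q, (X 0 1); split=> //.
  rewrite -[LHS](conj_mxK Q) // -/X; congr conj_mx.
  move: (Xc 0) (Xc 1) dX tX; clear; elim/mx2_ind: X => a b c d.
  rewrite mx2_det mx2_tr !mxE /= mulr1 mulr0 => -> -> _ /addrI ->.
  by [].
rewrite -[LHS](conj_mxK Q) // -/Y; congr conj_mx.
move: (Yc 0) (Yc 1) dY; rewrite -tY; clear; elim/mx2_ind: Y => a b c d.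
rewrite mx2_det mx2_tr !mxE /= => -> ->; rewrite mul0r mulr1 sub0r add0r => hb.
by have -> : b = - 1 by rewrite -hb opprK.
Qed.

Lemma two_neq0 : (2 : C) != 0.
Proof. by rewrite pnatr_eq0. Qed.

Lemma quadratic_root (a b c : C) : a <> 0 \/ b <> 0 ->
  exists r, a * r ^+ 2 + b * r + c = 0.
Proof.
have [->|a0] := eqVneq a 0.
  case=> // /eqP b0; exists (- c / b); rewrite mul0r add0r mulrC divfK //.
  by rewrite addNr.
move=> _; pose s := sqrtC (b ^+ 2 - 4 * a * c).
have hs : s ^+ 2 = b ^+ 2 - 4 * a * c by rewrite sqrtCK.
exists ((s - b) / (2 * a)).
have -> : a * ((s - b) / (2 * a)) ^+ 2 + b * ((s - b) / (2 * a)) + c =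
   (s ^+ 2 - (b ^+ 2 - 4 * a * c)) / (4 * a) by field.
by rewrite hs subrr mul0r.
Qed.

Lemma eigenvalues_SL2 (t : C) : t <> 2 -> t <> - 2 ->
  exists l m : C, [/\ l * m = 1, l + m = t & l <> m].
Proof.
move=> t1 t2; pose s := sqrtC (t ^+ 2 - 4).
have hs : s ^+ 2 = t ^+ 2 - 4 by rewrite sqrtCK.
exists ((t + s) / 2), ((t - s) / 2); split.
- have -> : (t + s) / 2 * ((t - s) / 2) = (t ^+ 2 - s ^+ 2) / 4 by field.
  by rewrite hs opprB addrC subrK divff // pnatr_eq0.
- by field.
move=> e; have s0 : s = 0.
  have -> : s = (t + s) / 2 - (t - s) / 2 by field.
  by rewrite e subrr.
have : (t - 2) * (t + 2) = 0 by move: hs; rewrite s0 expr0n => h;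
  transitivity (t ^+ 2 - 4); [ring|rewrite -h].
move=> /eqP; rewrite mulf_eq0 subr_eq0 addr_eq0 => /orP[]/eqP; [exact: t1|exact: t2].
Qed.

Lemma mulmx_inj0 (A : M2) (v : 'cV[C]_2) : \det A <> 0 -> A *m v = 0 -> v = 0.
Proof.
move=> /eqP dA h; have u : A \in unitmx by rewrite unitmxE unitfE.
by rewrite -(mulKmx u v) h mulmx0.
Qed.

(** As [t] is not 2 or -2, the eigenvectors of [x] contain a basis. A nonzero commutator cannot kill
    both basis vectors, and one that survives serves in [normal_form]. *)
Lemma noncommuting_normal_form (t : C) (x y : M2) : t <> 2 -> t <> - 2 ->
  \det x = 1 -> \det y = 1 -> \tr x = t -> comm x y <> 0 ->
  exists l m Q s, [/\ l * m = 1, l + m = t, l <> m, Q \in unitmx &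
    x = conj_mx Q (nf_x l s m) /\ y = conj_mx Q (nf_y (\tr y))].
Proof.
move=> t1 t2 dx dy tx nxy; have [l [m [lm ltm nlm]]] := eigenvalues_SL2 t t1 t2.
have tx1 : \tr x = l + m by rewrite ltm.
have tx2 : \tr x = m + l by rewrite addrC.
have [v v0 xv] := SL2_eigenvector x l m dx lm tx1.
have [w w0 xw] := SL2_eigenvector x m l dx (etrans (mulrC _ _) lm) tx2.
have [hv|hv] := classic (comm x y *m v = 0); last first.
  have [Q [s [Qu ex ey]]] := normal_form x y v l m dx dy tx1 v0 xv hv.
  by exists l, m, Q, s.
have [hw|hw] := classic (comm x y *m w = 0); last first.
  have [Q [s [Qu ex ey]]] := normal_form x y w m l dx dy tx2 w0 xw hw.
  by exists m, l, Q, s; split=> //; [rewrite mulrC|rewrite addrC|move=> e; apply: nlm].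
case: nxy.
have u : mx_cols v w \in unitmx.
  apply: mx_cols_unit => // k e; have : (l - m) *: w = 0.
    by rewrite scalerBl -xw {2}e -scalemxAr xv e !scalerA mulrC subrr.
  move/eqP; rewrite scalemx_eq0 subr_eq0 => /orP[/eqP|/eqP]; first exact: nlm.
  exact: w0.
rewrite -[LHS](mulmxK u).
suff -> : comm x y *m mx_cols v w = 0 by rewrite mul0mx.
apply/matrixP => i j.
have hj : forall v w (A : M2) i, (A *m mx_cols v w) i 0 = (A *m v) i 0 /\
    (A *m mx_cols v w) i 1 = (A *m w) i 0.
  by move=> v' w' A i'; rewrite !mxE !sum_ord2 !mxE.
have [h1 h2] := hj v w (comm x y) i; rewrite hv in h1; rewrite hw in h2.
rewrite [RHS]mxE in h1; rewrite [RHS]mxE in h2.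
case: j => -[|[|//]] hj'; rewrite [RHS]mxE.
  by rewrite -[RHS]h1; congr (_ _ _); exact/val_inj.
by rewrite -[RHS]h2; congr (_ _ _); exact/val_inj.
Qed.

Lemma nf_x_inv l s m : l * m = 1 -> invmx (nf_x l s m) = mx2 m (- s) 0 l.
Proof. by move=> h; rewrite /nf_x invmx_SL2 ?oppr0 // mulr0 subr0. Qed.

Lemma nf_y_inv t : invmx (nf_y t) = mx2 t 1 (- 1) 0.
Proof. by rewrite /nf_y invmx_SL2 ?opprK // mul0r mulr1 sub0r opprK. Qed.

Lemma unit_nf_x l s m : l * m = 1 -> nf_x l s m \in unitmx.
Proof. by move=> h; apply: unit_det1; rewrite mx2_det mulr0 subr0. Qed.

Lemma unit_nf_y t : nf_y t \in unitmx.
Proof. by apply: unit_det1; rewrite mx2_det mul0r mulr1 sub0r opprK. Qed.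

Lemma conj_mxM Q x y : Q \in unitmx -> conj_mx Q x *m conj_mx Q y = conj_mx Q (x *m y).
Proof. exact: mulmxJ. Qed.

(** An invertible commutator kills no eigenvector, so the same eigenvalue [l] can be used for both
    pairs. The remaining entry of the normal form is [t * l - \tr (y *m invmx x)], so both pairs
    have the same normal form. *)
Lemma irreducible_pair_conj (t : C) (x y x' y' : M2) : 
  \det x = 1 -> \det y = 1 -> \det x' = 1 -> \det y' = 1 ->
  \tr x = t -> \tr y = t -> \tr x' = t -> \tr y' = t ->
  \tr (y *m invmx x) = \tr (y' *m invmx x') -> \det (comm x y) <> 0 ->
  exists g, [/\ g \in unitmx, x' = conj_mx g x & y' = conj_mx g y].
Proof.
move=> dx dy dx' dy' tx ty tx' ty' e nd.
have nd' : \det (comm x' y') <> 0.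
  by rewrite (det_comm t) // -e -(det_comm t).
have [l [m [lm ltm]]] : exists l m : C, l * m = 1 /\ l + m = t.
  have [|r hr] := quadratic_root 1 (- t) 1; first by left; apply/eqP/oner_neq0.
  exists r, (t - r); split; last by rewrite addrC subrK.
  by apply/eqP; rewrite -subr_eq0 -[X in X == _]opprK oppr_eq0; apply/eqP; rewrite -hr; ring.
have key a b : \det a = 1 -> \det b = 1 -> \tr a = t -> \tr b = t ->
   \det (comm a b) <> 0 -> exists Q, [/\ Q \in unitmx,
    a = conj_mx Q (nf_x l (t * l - \tr (b *m invmx a)) m) & b = conj_mx Q (nf_y t)].
  move=> da db ta tb nab; have ta1 : \tr a = l + m by rewrite ltm.
  have [v v0 av] := SL2_eigenvector a l m da lm ta1.
  have [|Q [s [Qu ea eb]]] := normal_form a b v l m da db ta1 v0 av.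
    by move=> h; apply: v0; apply: mulmx_inj0 h.
  rewrite tb in eb; exists Q; split=> //; rewrite {1}ea; congr (conj_mx _ (nf_x _ _ _)).
  rewrite ea eb /conj_mx invmxJ ?unit_nf_x // mulmxJ // mxtraceJ // nf_x_inv //.
  by rewrite mx2M mx2_tr; ring.
have [Q [Qu ex ey]] := key _ _ dx dy tx ty nd.
have [Q' [Qu' ex' ey']] := key _ _ dx' dy' tx' ty' nd'.
have cc a : conj_mx (Q' *m invmx Q) (conj_mx Q a) = conj_mx Q' a.
  rewrite /conj_mx invmxM2 ?unitmx_inv // invmxK !mulmxA !mulmxKV //.
exists (Q' *m invmx Q); split.
- by rewrite unitmx_mul Qu' unitmx_inv.
- by rewrite [in RHS]ex cc e.
by rewrite [in RHS]ey cc.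
Qed.

(** The three trace conditions are linear in the entries of [z] and leave a line, with the lower
    left entry [r] as parameter. On it, determinant 1 is a quadratic equation in [r]; its leading
    coefficient is a nonzero multiple of [\det (comm x y)], and its linear coefficient vanishes for
    a single [be]. *)
Lemma third_vertex (t al : C) (x y : M2) : t <> 2 -> t <> - 2 ->
  \det x = 1 -> \det y = 1 -> \tr x = t -> \tr y = t -> comm x y <> 0 ->
  exists bad, forall be, \det (comm x y) <> 0 \/ be <> bad ->
  exists z, [/\ \det z = 1, \tr z = t, \tr (z *m invmx x) = al & \tr (z *m invmx y) = be].
Proof.
move=> t1 t2 dx dy tx ty nxy.
have [l [m [Q [s [lm ltm nlm Qu [ex ey]]]]]] :=
  noncommuting_normal_form t x y t1 t2 dx dy tx nxy.
rewrite ty in ey.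
have ml0 : m - l != 0 by rewrite subr_eq0 eq_sym; apply/eqP.
(* In normal form, the condition on [al] forces the upper left entry of [z] to be [p0 + p1 * r]. *)
pose p1 := s / (m - l); pose p0 := (al - t * l) / (m - l).
pose a := - p1 ^+ 2 - p1 * t - 1; pose b := p1 * t - 2 * p0 * p1 - p0 * t.
exists (- b) => be hbe.
have [|r hr] := quadratic_root a (b + be) (p0 * t - p0 ^+ 2 - 1).
  case: hbe => [hd|hb]; [left|right]; last first.
    by move=> h; apply: hb; apply/eqP; rewrite -addr_eq0 addrC h.
  move=> a0; apply: hd; rewrite ex ey /conj_mx commJ // det_conj //.
  rewrite /comm !mx2M mx2N mx2D mx2_det.
  transitivity (a * (m - l) ^+ 2); last by rewrite a0 mul0r.
  by rewrite /a /p1 -ltm; field.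
pose p := p0 + p1 * r.
exists (conj_mx Q (mx2 p (p * t + r - be) r (t - p))); split.
- rewrite det_conj // mx2_det; apply/eqP; rewrite -subr_eq0; apply/eqP.
  by rewrite -[RHS]hr /p /a /b; ring.
- by rewrite mxtraceJ // mx2_tr addrC subrK.
- rewrite ex /conj_mx invmxJ ?unit_nf_x // mulmxJ // mxtraceJ // nf_x_inv //.
  by rewrite mx2M mx2_tr /p /p0 /p1; field.
rewrite ey /conj_mx invmxJ ?unit_nf_y // mulmxJ // mxtraceJ // nf_y_inv //.
by rewrite mx2M mx2_tr; ring.
Qed.

(** * Polygons with prescribed edges *)

Lemma infinitely_many_cofinite (G : seq C) (P : C -> Prop) :
  (forall c, c \notin G -> P c) -> infinitely_many P.
Proof.
move=> h F; pose l := F ++ G; pose ks : seq C := [seq k%:R | k <- iota 0 (size l).+1].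
have /allPn[c _] : ~~ all (mem l) ks.
  apply/negP => /allP sub; have := @uniq_leq_size _ ks l.
  rewrite map_inj_in_uniq ?iota_uniq; last first.
    by move=> i j _ _ /eqP; rewrite eqr_nat => /eqP.
  by move=> /(_ isT sub); rewrite size_map size_iota ltnn.
by rewrite /= mem_cat negb_or => /andP[cF cG]; exists c => //; apply: h.
Qed.

(** For [t] other than 2 and -2 this is $G(t)$, since the two central elements have these traces. *)
Definition in_SL2t (t : C) (x : M2) : Prop := \det x = 1 /\ \tr x = t.

Definition congruent (a b u v : M2) : Prop :=
  exists g, [/\ g \in unitmx, u = conj_mx g a & v = conj_mx g b].

Definition generic_pair (t : C) (a b : M2) : Prop :=
  [/\ in_SL2t t a, in_SL2t t b & \det (comm a b) <> 0].

Lemma tr_divC (u v : M2) : \det u = 1 -> \det v = 1 ->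
  \tr (u *m invmx v) = \tr (v *m invmx u).
Proof.
elim/mx2_ind: u => a b c d; elim/mx2_ind: v => e f g h; rewrite !mx2_det => h1 h2.
by rewrite (invmx_SL2 _ _ _ _ h1) (invmx_SL2 _ _ _ _ h2) !mx2M !mx2_tr; ring.
Qed.

Lemma congruent_of_trace t a b u v : generic_pair t a b -> in_SL2t t u -> in_SL2t t v ->
  \tr (v *m invmx u) = \tr (b *m invmx a) -> congruent a b u v.
Proof.
move=> [[da ta] [db tb] nab] [du tu] [dv tv] e.
by have [g h] := irreducible_pair_conj t a b u v da db du dv ta tb tu tv (esym e) nab; exists g.
Qed.

Lemma det_comm_neq0 t x y : in_SL2t t x -> in_SL2t t y ->
  \tr (y *m invmx x) <> 2 -> \tr (y *m invmx x) <> t ^+ 2 - 2 -> \det (comm x y) <> 0.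
Proof.
move=> [dx tx] [dy ty] n1 n2; rewrite (det_comm t) // => /eqP.
by rewrite oppr_eq0 mulf_eq0 !subr_eq0 => /orP[]/eqP.
Qed.

Lemma trace_neq t x y : in_SL2t t x -> in_SL2t t y -> \det (comm x y) <> 0 ->
  \tr (y *m invmx x) <> 2 /\ \tr (y *m invmx x) <> t ^+ 2 - 2.
Proof.
move=> [dx tx] [dy ty] n; rewrite (det_comm t) // in n.
by split=> e; apply: n; rewrite e subrr ?mulr0 ?mul0r oppr0.
Qed.

Lemma det_comm_sym (x y : M2) : \det (comm x y) = \det (comm y x).
Proof.
elim/mx2_ind: x => a b c d; elim/mx2_ind: y => e f g h.
by rewrite /comm !mx2M !mx2N !mx2D !mx2_det; ring.
Qed.

Lemma comm_neq0 (x y : M2) : \det (comm x y) <> 0 -> comm x y <> 0.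
Proof. by move=> h e; apply: h; rewrite e det0. Qed.

Lemma rev_iotaS i m : rev (iota i m.+1) = (i + m)%N :: rev (iota i m).
Proof. by rewrite -addn1 iotaD rev_cat. Qed.

(** The induction cuts off the last triangle [(p, u, v)]: the diagonal from [p] to the new vertex
    [u] gets a free value, and the edge from [u] to [v] its prescribed one. Diagonals are listed
    from the last to the first, in the order in which they are chosen. In the base case a single
    triangle has two prescribed edges. *)
Lemma fan_of_triangles (t : C) (a b : nat -> M2) m (p v : M2) : t <> 2 -> t <> - 2 ->
  (forall i, (1 <= i <= m.+2)%N -> generic_pair t (a i) (b i)) ->
  in_SL2t t p -> in_SL2t t v -> \det (comm p v) <> 0 ->
  large m (fun cs => exists x : nat -> M2, [/\ x 1%N = p, x m.+3 = v,
    forall i, (1 <= i <= m.+2)%N -> congruent (a i) (b i) (x i) (x i.+1) &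
    [seq \tr (x i *m invmx p) | i <- rev (iota 3 m)] = cs]).
Proof.
move=> t1 t2; elim: m v => [|m IH] v gen [dp tp] [dv tv] npv.
  have [|u [du tu e1 e2]] := proj2_sig (constructive_indefinite_description _
    (third_vertex t (\tr (b 1%N *m invmx (a 1%N))) p v t1 t2 dp dv tp tv (comm_neq0 _ _ npv)))
    (\tr (b 2 *m invmx (a 2))); first by left.
  exists (fun i => if i is 1 then p else if i is 2 then u else v).
  split; [by []|by []|move=> [|[|[|i]]] hi|by []].
  - by [].
  - exact: (congruent_of_trace t _ _ _ _ (gen 1%N isT) (conj dp tp) (conj du tu) e1).
  - apply: (congruent_of_trace t _ _ _ _ (gen 2 isT) (conj du tu) (conj dv tv)).
    by rewrite (tr_divC v u dv du) e2.
  - by [].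
(* Avoiding these two values keeps the commutator of [p] and [u] invertible, as the next triangle
   requires. *)
apply: (infinitely_many_cofinite [:: 2; t ^+ 2 - 2]) => c.
rewrite !inE negb_or => /andP[/eqP c1 /eqP c2].
have nvp : \det (comm v p) <> 0 by rewrite det_comm_sym.
have [bad] := third_vertex t (\tr (b m.+3 *m invmx (a m.+3))) v p t1 t2 dv dp tv tp
  (comm_neq0 _ _ nvp).
case/(_ c (or_introl nvp)) => u [du tu e1 e2].
have npu : \det (comm p u) <> 0.
  by apply: (det_comm_neq0 t _ _ (conj dp tp) (conj du tu)); rewrite e2.
have gen' i : (1 <= i <= m.+2)%N -> generic_pair t (a i) (b i) by move=> hi; apply: gen; lia.
apply: largeW (IH u gen' (conj dp tp) (conj du tu) npu) => cs _ [x [x1 xu xe xc]].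
exists (fun i => if i == m.+4 then v else x i); split; [exact: x1|by rewrite eqxx| |].
  move=> i /andP[i1 i2]; have -> : i == m.+4 = false by lia.
  rewrite eqSS; have [->|ni] := eqVneq i m.+3.
    rewrite xu; apply: (congruent_of_trace t _ _ _ _ _ (conj du tu) (conj dv tv)).
      by apply: gen; lia.
    by rewrite -e1 (tr_divC _ _ dv du).
  by apply: xe; lia.
rewrite rev_iotaS /= !addSn add0n; have -> : m.+3 == m.+4 = false by lia.
rewrite xu e2 -xc; congr (_ :: _); apply/eq_in_map => i.
rewrite mem_rev mem_iota => hi; by have -> : i == m.+4 = false by lia.
Qed.

(** Indices 0 and [n.+1] name the same vertex. The last clause will make the resulting
    representation irreducible. *)
Definition polygon (t : C) (a b : nat -> M2) n (x : nat -> M2) : Prop :=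
  [/\ x n.+1 = x 0%N, forall i, (i <= n)%N -> congruent (a i) (b i) (x i) (x i.+1),
    \tr (x 1%N) = t & \det (comm (x 1%N) (x n)) <> 0].

(** Edge 0 is placed as it stands, from [a 0] to [b 0]. The vertex [u] is chosen to have the right
    edge back to [a 0], and a fan at [b 0] fills the part between [b 0] and [u]. *)
Lemma polygon_of_last_vertex (t : C) (a b : nat -> M2) n u : (3 <= n)%N -> t <> 2 -> t <> - 2 ->
  in_SL2t t (a 0%N) -> in_SL2t t (b 0%N) ->
  (forall i, (1 <= i <= n)%N -> generic_pair t (a i) (b i)) ->
  in_SL2t t u -> \tr (u *m invmx (a 0%N)) = \tr (b n *m invmx (a n)) ->
  \det (comm (b 0%N) u) <> 0 ->
  large (n - 3) (fun cs => exists x, [/\ polygon t a b n x, x 1%N = b 0%N, x n = u &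
    [seq \tr (x i *m invmx (b 0%N)) | i <- rev (iota 3 (n - 3))] = cs]).
Proof.
move=> n3 t1 t2 ga gb gen gu eu nu.
have [m en] : exists m, n = m.+3 by exists (n - 3)%N; lia.
subst n; rewrite subSS subn2 /=.
have gen' i : (1 <= i <= m.+2)%N -> generic_pair t (a i) (b i) by move=> hi; apply: gen; lia.
apply: largeW (fan_of_triangles t a b m (b 0%N) u t1 t2 gen' gb gu nu) => cs _ [x [x1 xu xe xc]].
pose x' i := if (i == 0)%N || (i == m.+4) then a 0%N else x i.
have x'E i : (1 <= i <= m.+3)%N -> x' i = x i.
  by move=> hi; rewrite /x' ifF //; lia.
have x'1 : x' 1%N = b 0%N by rewrite x'E.
have x'l : x' m.+3 = u by rewrite x'E ?leqnn.
have x'c : x' m.+4 = a 0%N by rewrite /x' eqxx.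
exists x'; split; [split|exact: x'1|exact: x'l|].
- exact: x'c.
- move=> i hi; have [->|i0] := posnP i.
    by rewrite x'1; exists 1%:M; rewrite unitmx1 /conj_mx invmx1 !mul1mx !mulmx1.
  have [->|ni] := eqVneq i m.+3.
    rewrite x'l x'c; apply: (congruent_of_trace t _ _ _ _ (gen _ _) gu ga).
      by rewrite leqnn.
    by rewrite -eu (tr_divC _ _ (proj1 ga) (proj1 gu)).
  by rewrite !x'E; [apply: xe| |]; lia.
- by rewrite x'1; case: gb.
- by rewrite x'1 x'l.
rewrite -xc; apply/eq_in_map => i; rewrite mem_rev mem_iota => hi.
by rewrite x'E //; lia.
Qed.

(** When [a 0] and [b 0] do not commute, the last vertex can be given the right edge to [a 0]
    together with almost any diagonal to [b 0]; this is one more free value. *)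
Lemma polygons_noncommuting (t : C) (a b : nat -> M2) n : (3 <= n)%N -> t <> 2 -> t <> - 2 ->
  in_SL2t t (a 0%N) -> in_SL2t t (b 0%N) ->
  (forall i, (1 <= i <= n)%N -> generic_pair t (a i) (b i)) ->
  comm (a 0%N) (b 0%N) <> 0 ->
  large (n - 2) (fun cs => exists2 x, polygon t a b n x &
    [seq \tr (x i *m invmx (x 1%N)) | i <- rev (iota 3 (n - 2))] = cs).
Proof.
move=> n3 t1 t2 [da ta] [db tb] gen nab.
have [bad hbad] := third_vertex t (\tr (b n *m invmx (a n))) _ _ t1 t2 da db ta tb nab.
have -> : (n - 2 = (n - 3).+1)%N by lia.
(* [bad] obstructs the construction of [u]; at the other two values [b 0] and [u] would have a
   common eigenvector. *)
apply: (infinitely_many_cofinite [:: bad; 2; t ^+ 2 - 2]) => c.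
rewrite !inE !negb_or => /and3P[/eqP c0 /eqP c1 /eqP c2].
have [u [du tu e1 e2]] := hbad c (or_intror c0).
have nu : \det (comm (b 0%N) u) <> 0.
  by apply: (det_comm_neq0 t _ _ (conj db tb) (conj du tu)); rewrite e2.
apply: largeW (polygon_of_last_vertex t a b n u n3 t1 t2 (conj da ta) (conj db tb) gen
  (conj du tu) e1 nu) => cs _ [x [px x1 xu xc]].
exists x; first exact: px.
have n3' : (3 + (n - 3) = n)%N by lia.
by rewrite rev_iotaS /= x1 n3' xu e2 xc.
Qed.

Lemma not_scalar_SL2 (t a : C) : t <> 2 -> t <> - 2 -> in_SL2t t a%:M -> False.
Proof.
move=> t1 t2; rewrite /in_SL2t mx2_scal mx2_det mx2_tr mulr0 subr0 => -[h1 h2].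
have : (t - 2) * (t + 2) = 0.
  by transitivity (4 * (a * a - 1)); [rewrite -h2; ring|rewrite h1 subrr mulr0].
by move=> /eqP; rewrite mulf_eq0 subr_eq0 addr_eq0 => /orP[]/eqP.
Qed.

(** Two explicit candidates suffice: for [t] nonzero a matrix commuting with both is scalar, and a
    scalar in SL2 has trace 2 or -2. *)
Lemma exists_noncommuting (t : C) (x : M2) : t <> 0 -> t <> 2 -> t <> - 2 ->
  in_SL2t t x -> exists2 y, in_SL2t t y & comm x y <> 0.
Proof.
move=> t0 t1 t2 gx; pose y1 := mx2 0 (- 1) 1 t; pose y2 := mx2 t (- 1) 1 0.
have [h1|] := classic (comm x y1 = 0); last first.
  by exists y1; [split; [rewrite mx2_det|rewrite mx2_tr]; ring|].
have [h2|] := classic (comm x y2 = 0); last first.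
  by exists y2; [split; [rewrite mx2_det|rewrite mx2_tr]; ring|].
case: (not_scalar_SL2 t (x 0 0) t1 t2).
move: gx h1 h2; elim/mx2_ind: x => a b c d gx.
rewrite /comm !mx2M !mx2N !mx2D mx2_0 => /mx2_inj[p1 p2 p3 p4] /mx2_inj[q1 q2 q3 q4].
have c0 : c = 0.
  have : (2 * t) * c = 0.
    transitivity ((c * t + d * 1 - (1 * a + 0 * c)) - (c * 0 + d * 1 - (1 * a + t * c))); first by ring.
    by rewrite q3 p3 subrr.
  move=> /eqP; rewrite !mulf_eq0 (negPf two_neq0) /= => /orP[]/eqP //.
have b0 : b = 0 by rewrite -[RHS]p1 c0; ring.
have d0 : d = a by apply/eqP; rewrite -subr_eq0 -[X in _ == X]p3 c0; apply/eqP; ring.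
by move: gx; rewrite mx2_scal mxE /= d0 b0 c0.
Qed.

(** What commutes with a companion matrix is a linear polynomial in it. So [y] is [al%:M + be *: x],
    where [be] is nonzero because [y] is not scalar, and [comm y u] is [be] times [comm x u]. *)
Lemma centralizer_SL2 (t : C) (x y u : M2) : t <> 2 -> t <> - 2 ->
  in_SL2t t x -> in_SL2t t y -> in_SL2t t u ->
  comm x y = 0 -> \det (comm x u) <> 0 -> \det (comm y u) <> 0.
Proof.
move=> t1 t2 [dx tx] gy [du tu] cxy nxu.
have nux : comm u x <> 0 by apply: comm_neq0; rewrite det_comm_sym.
have [l [m [Q [s [_ _ _ Qu [_ ex]]]]]] :=
  noncommuting_normal_form t u x t1 t2 du dx tu nux.
rewrite tx in ex.
have [al [be yE]] : exists al be, y = al%:M + be *: x.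
  pose Y := conj_mx (invmx Q) y.
  have cY : comm (nf_y t) Y = 0.
    have Qiu : invmx Q \in unitmx by rewrite unitmx_inv.
    have -> : nf_y t = conj_mx (invmx Q) x.
      by rewrite ex /conj_mx invmxK !mulmxA (mulVmx Qu) mul1mx (mulmxKV Qu).
    by rewrite /Y /conj_mx (commJ _ _ _ Qiu) cxy mulmx0 mul0mx.
  have [al [be hY]] : exists al be, Y = al%:M + be *: nf_y t.
    exists (Y 0 0), (Y 1 0); move: cY; clear; elim/mx2_ind: Y => a b c d.
    rewrite /comm /nf_y !mx2M !mx2N !mx2D mx2_0 => /mx2_inj[p1 p2 p3 p4].
    rewrite mx2Z mx2_scal mx2D !mxE /=; congr mx2; try ring.
      by apply/eqP; rewrite -subr_eq0 -oppr_eq0 -[X in _ == X]p1; apply/eqP; ring.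
    by apply/eqP; rewrite -subr_eq0 -oppr_eq0 -[X in _ == X]p3; apply/eqP; ring.
  exists al, be; rewrite -[LHS](conj_mxK Q _ Qu) -/Y hY ex /conj_mx.
  rewrite mulmxDr mulmxDl -scalemxAr -scalemxAl; congr (_ + _).
  by rewrite mul_mx_scalar -scalemxAl (mulmxV Qu) scalemx1.
have be0 : be != 0.
  by apply/eqP => b0; apply: (not_scalar_SL2 t al t1 t2); move: gy; rewrite yE b0 scale0r addr0.
have -> : comm y u = be *: comm x u.
  rewrite /comm yE mulmxDl mulmxDr scalar_mxC -scalemxAl -scalemxAr scalerBr.
  by rewrite opprD addrACA subrr add0r.
by rewrite detZ => /eqP; rewrite mulf_eq0 expf_eq0 (negPf be0) /= => /eqP.
Qed.

(** A single last vertex [u] is found and its diagonal is not varied, which costs one free value. If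
    [a 0] and [b 0] commute, the prescribed edge already makes the commutator of [a 0] and [u]
    invertible, and [centralizer_SL2] passes this on to [b 0]. *)
Lemma polygons (t : C) (a b : nat -> M2) n : (3 <= n)%N -> t <> 0 -> t <> 2 -> t <> - 2 ->
  in_SL2t t (a 0%N) -> in_SL2t t (b 0%N) ->
  (forall i, (1 <= i <= n)%N -> generic_pair t (a i) (b i)) ->
  large (n - 3) (fun cs => exists2 x, polygon t a b n x &
    [seq \tr (x i *m invmx (x 1%N)) | i <- rev (iota 3 (n - 3))] = cs).
Proof.
move=> n3 t0 t1 t2 ga gb gen.
suff [u [gu eu nu]] : exists u, [/\ in_SL2t t u,
    \tr (u *m invmx (a 0%N)) = \tr (b n *m invmx (a n)) & \det (comm (b 0%N) u) <> 0].
  apply: largeW (polygon_of_last_vertex t a b n u n3 t1 t2 ga gb gen gu eu nu).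
  by move=> cs _ [x [px x1 xu xc]]; exists x; [exact: px|rewrite x1].
have [da ta] := ga; have [db tb] := gb.
have pick (G : seq C) : exists c : C, c \notin G.
  by have [c cG _] := infinitely_many_cofinite [::] (fun=> True) (fun _ _ => I) G; exists c.
have [cab|nab] := classic (comm (a 0%N) (b 0%N) = 0); last first.
  have [bad hbad] := third_vertex t (\tr (b n *m invmx (a n))) _ _ t1 t2 da db ta tb nab.
  have [c] := pick [:: bad; 2; t ^+ 2 - 2].
  rewrite !inE !negb_or => /and3P[/eqP c0 /eqP c1 /eqP c2].
  have [u [du tu e1 e2]] := hbad c (or_intror c0).
  exists u; split; [exact: conj|exact: e1|].
  by apply: (det_comm_neq0 t _ _ gb (conj du tu)); rewrite e2.
(* The auxiliary [y] only provides a noncommuting pair to which [third_vertex] applies; the trace of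
   [u] against [y] is immaterial. *)
have [y [dy ty] nay] := exists_noncommuting t _ t0 t1 t2 ga.
have [bad hbad] := third_vertex t (\tr (b n *m invmx (a n))) _ _ t1 t2 da dy ta ty nay.
have [c] := pick [:: bad]; rewrite inE => /eqP c0.
have [u [du tu e1 _]] := hbad c (or_intror c0).
exists u; split; [exact: conj|exact: e1|].
apply: (centralizer_SL2 t _ _ _ t1 t2 ga gb (conj du tu) cab).
have [gan gbn nn] := gen n (introT andP (conj (leq_trans (isT : (0 < 3)%N) n3) (leqnn n))).
by have [z1 z2] := trace_neq t _ _ gan gbn nn; apply: (det_comm_neq0 t _ _ ga (conj du tu)); rewrite e1.
Qed.

(** * Gluing representations of tangles *)

Lemma valid_foldl w s w' : valid w s w' -> foldl piece_width w s = w'.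
Proof. by elim: s w => [|p s IH] w /=; [move/eqP|move=> /andP[_ /IH]]. Qed.

Lemma wid_size w s w' : valid w s w' -> wid w s (size s) = w'.
Proof. by rewrite /wid take_size; apply: valid_foldl. Qed.

Lemma valid_cat w s1 w1 s2 w2 : valid w s1 w1 -> valid w1 s2 w2 -> valid w (s1 ++ s2) w2.
Proof.
elim: s1 w => [|p s1 IH] w /=; first by move=> /eqP ->.
by move=> /andP[-> h] /= h2; apply: IH.
Qed.

Lemma valid_piece_ok w s w' k : valid w s w' -> (k < size s)%N ->
  piece_ok (wid w s k) (nth (Birth 0) s k).
Proof.
elim: s w k => // p s IH w [|k] /= /andP[ok v] ks; first by rewrite /wid take0.
exact: IH v ks.
Qed.

Lemma widS w s k : (k < size s)%N ->
  wid w s k.+1 = piece_width (wid w s k) (nth (Birth 0) s k).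
Proof. by move=> ks; rewrite /wid (take_nth (Birth 0)) // foldl_rcons. Qed.

Lemma wid_catl w s1 s2 k : (k <= size s1)%N -> wid w (s1 ++ s2) k = wid w s1 k.
Proof. by move=> h; rewrite /wid takel_cat. Qed.

Lemma wid_catr w s1 w1 s2 k : valid w s1 w1 ->
  wid w (s1 ++ s2) (size s1 + k) = wid w1 s2 k.
Proof.
move=> v; rewrite /wid take_cat ltnNge leq_addr /= addKn foldl_cat.
by rewrite (valid_foldl _ _ _ v).
Qed.

Lemma piece_rep_ext w p (x x' y y' : level) : piece_ok w p ->
  (forall j, (j < w)%N -> x j = x' j) ->
  (forall j, (j < piece_width w p)%N -> y j = y' j) ->
  piece_rep w p x y -> piece_rep w p x' y'.
Proof.
case: p => [i b|i|i] /= ok ex ey.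
- have i0 : (i < w)%N by lia.
  case=> h1 h2; split=> [j jw ji ji1|]; first by rewrite -ey // -ex // h1.
  by move: h2; rewrite !ex // !ey.
- case=> h1 [h2 h3]; split; [|split].
  + by move=> j ji; rewrite -ey -?ex ?h1 //; lia.
  + by move=> j ji; rewrite -ey -?ex ?h2 //; lia.
  + by rewrite -!ey //; lia.
case=> h1 [h2 h3]; split; [|split].
+ by move=> j ji; rewrite -ey -?ex ?h1 //; lia.
+ by move=> j ji jw; rewrite -ey -?ex ?h2 //; lia.
+ by rewrite -!ex //; lia.
Qed.

(** The junction level [m] is taken from [r2]. *)
Definition glue (m : nat) (r1 r2 : nat -> level) : nat -> level :=
  fun k => if (k < m)%N then r1 k else r2 (k - m)%N.

Lemma glueD m r1 r2 k : glue m r1 r2 (m + k)%N = r2 k.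
Proof. by rewrite /glue ltnNge leq_addr /= addKn. Qed.

Lemma is_rep_cat w s1 w1 s2 w2 r1 r2 : valid w s1 w1 -> valid w1 s2 w2 ->
  is_rep w s1 r1 -> is_rep w1 s2 r2 ->
  (forall j, (j < w1)%N -> r1 (size s1) j = r2 0%N j) ->
  is_rep w (s1 ++ s2) (glue (size s1) r1 r2).
Proof.
move=> v1 v2 [p1 h1] [p2 h2] e; split.
  move=> [k j]; rewrite /point_ok /= size_cat => -[ks jw].
  have [km|km] := ltnP k (size s1).
    rewrite /glue km; apply: (p1 (k, j)); split=> /=; first exact: ltnW.
    by move: jw; rewrite wid_catl // ltnW.
  move: ks jw; rewrite -(subnKC km) leq_add2l (wid_catr _ _ _ _ _ v1) glueD => ks jw.
  exact: (p2 (_, j)).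
move=> k; rewrite size_cat nth_cat => ks.
have [km|km] := ltnP k (size s1); last first.
  move: ks; rewrite -(subnKC km) ltn_add2l -addnS !glueD (wid_catr _ _ _ _ _ v1) addKn.
  exact: h2.
rewrite (wid_catl _ _ _ _ (ltnW km)).
apply: piece_rep_ext (h1 _ km); first exact: valid_piece_ok v1 km.
  by move=> j _; rewrite /glue km.
rewrite -widS // => j jw; rewrite /glue; case: ltnP => // km'.
have ek : k.+1 = size s1 by apply/eqP; rewrite eqn_leq km.
by rewrite ek subnn; apply: e; rewrite -(wid_size _ _ _ v1) -ek.
Qed.

(** The strands that [denominator] adds to the left and right of a tangle level of width [w];
    positions further right get the default [R]. *)
Definition pad (w : nat) (L R : M2) (x : level) : level :=
  fun j => if j is j'.+1 then if (j' < w)%N then x j' else R else L.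

Lemma piece_width_shift w p : piece_ok w p ->
  piece_width w.+2 (shift_piece p) = (piece_width w p).+2.
Proof. by case: p => [i b|i|i] //=; case: w => [|[|]]. Qed.

Lemma valid_shift w s w' : valid w s w' -> valid w.+2 (map shift_piece s) w'.+2.
Proof.
elim: s w => [|p s IH] w /=; first by move=> /eqP ->.
move=> /andP[ok /IH]; rewrite piece_width_shift // => ->; rewrite andbT.
by case: p ok => [i b|i|i] /=; lia.
Qed.

Lemma wid_shift w s w' k : valid w s w' -> (k <= size s)%N ->
  wid w.+2 (map shift_piece s) k = (wid w s k).+2.
Proof.
move=> v; elim: k => [|k IH] ks; first by rewrite /wid !take0.
have ks' : (k < size (map shift_piece s))%N by rewrite size_map.
rewrite (widS w _ _ ks) (widS w.+2 _ _ ks') (nth_map (Birth 0) _ _ ks) IH; last exact: ltnW.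
exact/piece_width_shift/(valid_piece_ok _ _ _ _ v ks).
Qed.

Lemma piece_rep_pad w p L R x y : piece_ok w p -> piece_rep w p x y ->
  piece_rep w.+2 (shift_piece p) (pad w L R x) (pad (piece_width w p) L R y).
Proof.
case: p => [i b|i|i] /= ok.
- have i0 : (i < w)%N by lia.
  case=> h1 h2; split; last by rewrite ok i0.
  move=> [|j] //= jw ji ji1; case: ifP => // jw'; apply: h1 => // e; [apply: ji|apply: ji1];
    by rewrite e.
- case=> h1 [h2 h3]; split; [|split].
  + by move=> [|j] //= ji; rewrite !ifT ?h1 //; lia.
  + by move=> [|j] //= ji; rewrite ltnS ltnS; case: ifP => // jw; apply: h2; lia.
  + by rewrite !ifT //; lia.
case=> h1 [h2 h3]; split; [|split].
+ by move=> [|j] //= ji; rewrite !ifT ?h1 //; lia.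
+ move=> [|j] //= ji jw; have [h|h] := ltnP j.+2 w.
    by rewrite ifT ?h2 //; lia.
  by rewrite ifF //; lia.
by rewrite !ifT //; lia.
Qed.

Lemma is_rep_pad w s w' L R r : valid w s w' -> inSL2 L -> inSL2 R ->
  is_rep w s r ->
  is_rep w.+2 (map shift_piece s) (fun k => pad (wid w s k) L R (r k)).
Proof.
move=> v dL dR [p h]; split.
  move=> [k [|j]]; rewrite /point_ok /= size_map => -[ks jw] //.
  by case: ifP => // jw'; apply: (p (k, j)).
move=> k; rewrite size_map => ks.
rewrite (wid_shift _ _ _ _ v (ltnW ks)) (nth_map (Birth 0)) // widS //.
by apply: piece_rep_pad (h _ ks); apply: valid_piece_ok v ks.
Qed.

Lemma invmx_conj (g x : M2) : g \in unitmx -> invmx (conj_mx g x) = conj_mx g (invmx x).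
Proof.
move=> u; have [xu|xu] := boolP (x \in unitmx); first exact: invmxJ.
rewrite /conj_mx (invmx_out xu) invmx_out //.
by rewrite -topredE /= !unitmx_mul unitmx_inv u /= andbT.
Qed.

Lemma is_rep_conj w s r g : g \in unitmx -> is_rep w s r ->
  is_rep w s (fun k j => conj_mx g (r k j)).
Proof.
move=> u [p h]; split; first by move=> q /p; rewrite /inSL2 det_conj.
move=> k /h; case: (nth _ _ _) => [i b|i|i] /= [h1 h2]; split.
- by move=> j jw ji ji1; rewrite h1.
- by case: b h2 => -[-> ->]; rewrite ?invmx_conj // ?conj_mxM.
- by move=> j ji; rewrite h1.
- by case: h2 => h2 ->; split=> [j jw|]; rewrite ?h2 ?invmx_conj.
- by move=> j ji; rewrite h1.
by case: h2 => h2 ->; split=> [j ji jw|]; rewrite ?h2 ?invmx_conj.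
Qed.

(** * Invariance of the product along a level *)

Definition level_prod (w : nat) (x : level) : M2 := \prod_(j <- iota 0 w) x j.

Lemma level_prod_eq w (x y : level) :
  (forall j, (j < w)%N -> x j = y j) -> level_prod w x = level_prod w y.
Proof.
move=> h; apply: eq_big_seq => j; rewrite mem_iota => /andP[_ jw]; exact: h.
Qed.

Lemma level_prod_split i m (x : level) :
  level_prod (i + m.+2)%N x =
  level_prod i x * (x i * x i.+1) * level_prod m (fun j => x (i + j.+2)%N).
Proof.
rewrite /level_prod iotaD big_cat /= !big_cons add0n -!mulrA; congr (_ * (_ * (_ * _))).
rewrite -[i.+2]addn0 iotaDl big_map; apply: eq_bigr => j _; congr x; lia.
Qed.

(** A crossing changes two adjacent factors but not their product, by the Wirtinger relation; a
    maximum or minimum inserts or removes two adjacent inverse factors. *)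
Lemma level_prod_piece w p x y : piece_ok w p ->
  (forall j, (j < w)%N -> inSL2 (x j)) ->
  (forall j, (j < piece_width w p)%N -> inSL2 (y j)) ->
  piece_rep w p x y -> level_prod (piece_width w p) y = level_prod w x.
Proof.
case: p => [i b|i|i] /= ok dx dy.
- case=> h1 h2; have [m ew] : exists m, w = (i + m.+2)%N by exists (w - i.+2)%N; lia.
  subst w; rewrite !level_prod_split; congr (_ * _ * _).
  + by apply: level_prod_eq => j ji; apply: h1; lia.
  + have u1 : x i \in unitmx by apply/unit_det1/dx; lia.
    have u2 : x i.+1 \in unitmx by apply/unit_det1/dx; lia.
    case: b h2 => -[-> ->]; first by apply: (mulmxKV u1).
    by rewrite -[LHS]/(x i.+1 *m (invmx (x i.+1) *m x i *m x i.+1)) -mulmxA (mulKVmx u2).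
  + by apply: level_prod_eq => j jm; apply: h1; lia.
- case=> h1 [h2 h3]; have [m ew] : exists m, w = (i + m)%N by exists (w - i)%N; lia.
  subst w; have -> : ((i + m).+2 = i + m.+2)%N by lia.
  rewrite level_prod_split h3.
  have -> : y i * invmx (y i) = 1 by apply/mulmxV/unit_det1/dy; lia.
  rewrite mulr1 /level_prod iotaD big_cat /=; congr (_ * _).
    by apply: eq_big_seq => j; rewrite mem_iota => hj; apply: h1; lia.
  rewrite add0n -[i in RHS]addn0 iotaDl big_map; apply: eq_big_seq => j.
  by rewrite mem_iota => hj; rewrite !addnS h2 //; lia.
case=> h1 [h2 h3]; have [m ew] : exists m, w = (i + m.+2)%N by exists (w - i.+2)%N; lia.
subst w; rewrite level_prod_split h3.
have -> : x i * invmx (x i) = 1 by apply/mulmxV/unit_det1/dx; lia.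
have -> : ((i + m.+2).-2 = i + m)%N by lia.
rewrite mulr1 /level_prod iotaD big_cat /=; congr (_ * _).
  by apply: eq_big_seq => j; rewrite mem_iota => hj; apply: h1; lia.
rewrite add0n -[i in LHS]addn0 iotaDl big_map; apply: eq_big_seq => j.
by rewrite mem_iota => hj; rewrite !addnS h2 //; lia.
Qed.

Lemma level_prod_rep w s w' r k : valid w s w' -> is_rep w s r -> (k <= size s)%N ->
  level_prod (wid w s k) (r k) = level_prod w (r 0%N).
Proof.
move=> v [p h]; elim: k => [|k IH] ks; first by rewrite /wid take0.
rewrite -(IH (ltnW ks)) (widS _ _ _ ks); apply: level_prod_piece (h _ ks).
- exact: valid_piece_ok v ks.
- by move=> j jw; apply: (p (k, j)); split; [exact: ltnW|].
by rewrite -(widS _ _ _ ks) => j jw; apply: (p (k.+1, j)).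
Qed.

Definition inverse_pair (z : level) (x : M2) : Prop := z 0%N = x /\ z 1%N = invmx x.

Lemma level_prod2 (x : level) : level_prod 2 x = x 0%N *m x 1%N.
Proof. by rewrite /level_prod /= !big_cons big_nil mulr1. Qed.

Lemma inverse_pair_prod (z : level) : inSL2 (z 0%N) -> level_prod 2 z = 1 ->
  inverse_pair z (z 0%N).
Proof.
move=> d h; split; first exact: erefl.
by rewrite -(mulKmx (unit_det1 _ d) (z 1%N)) -level_prod2 h mulmx1.
Qed.

(** [g_rho s r = 1%:M] says that the product along the top level is 1; its invariance carries this
    to the bottom. *)
Lemma tangle_inverse_pairs s r : tangle22 s -> is_rep 2 s r -> g_rho s r = 1%:M ->
  inverse_pair (r 0%N) (r 0%N 0%N) /\ inverse_pair (r (size s)) (r (size s) 0%N).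
Proof.
move=> v rep; have [p _] := rep; rewrite /g_rho /rho_nw /rho_ne => hg.
have d0 : inSL2 (r 0%N 0%N) by apply: (p (0%N, 0%N)); rewrite /point_ok /= /wid take0.
have d1 : inSL2 (r 0%N 1%N) by apply: (p (0%N, 1%N)); rewrite /point_ok /= /wid take0.
have ds : inSL2 (r (size s) 0%N).
  by apply: (p (size s, 0%N)); split; rewrite /= ?(wid_size _ _ _ v).
have top : level_prod 2 (r 0%N) = 1.
  rewrite level_prod2 -[r 0%N 0%N]mulmx1 -hg (mulKVmx (unit_det1 _ d0)).
  exact: (mulVmx (unit_det1 _ d1)).
split; apply: inverse_pair_prod; [exact: d0|exact: top|exact: ds|].
by rewrite -top -(level_prod_rep _ _ _ _ _ v rep (leqnn _)) (wid_size _ _ _ v).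
Qed.

(** * Chains of tangles and their closure *)

Definition chain_at (T : nat -> diagram) (m k : nat) : diagram :=
  flatten [seq T i | i <- iota m k].

Lemma chain_atS T m k : chain_at T m k.+1 = T m ++ chain_at T m.+1 k.
Proof. by []. Qed.

Lemma valid_chain T m k : (forall i, (m <= i < m + k)%N -> tangle22 (T i)) ->
  valid 2 (chain_at T m k) 2.
Proof.
elim: k m => // k IH m h; rewrite chain_atS; apply: (valid_cat _ _ 2).
  by apply: h; lia.
by apply: IH => i hi; apply: h; lia.
Qed.

Lemma rep_chain (T : nat -> diagram) (sg : nat -> nat -> level) (x : nat -> M2) m k :
  (forall i, (m <= i < m + k)%N -> [/\ tangle22 (T i), is_rep 2 (T i) (sg i),
     inverse_pair (sg i 0%N) (x i) & inverse_pair (sg i (size (T i))) (x i.+1)]) ->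
  inSL2 (x (m + k)%N) ->
  exists2 r, is_rep 2 (chain_at T m k) r &
    forall i, (i <= k)%N -> inverse_pair (r (size (chain_at T m i))) (x (m + i)%N).
Proof.
elim: k m => [|k IH] m h dx.
  rewrite addn0 in dx.
  (* The empty chain has one level, which carries the pair of [x m] and its inverse. *)
  exists (fun _ j => if j is 0 then x m else invmx (x m)).
    split; last by [].
    by move=> [q [|j]] _ /=; [exact: dx|exact: det_inv1].
  by case=> // _; rewrite addn0.
have [vT rT top bot] := h m ltac:(lia).
have [||r rr hr] := IH m.+1.
- by move=> i hi; apply: h; lia.
- by rewrite addSnnS.
have vC : valid 2 (chain_at T m.+1 k) 2.
  by apply: valid_chain => i hi; have [] := h i ltac:(lia).
have junction : inverse_pair (r 0%N) (x m.+1) by have := hr 0%N isT; rewrite addn0.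
exists (glue (size (T m)) (sg m) r).
  rewrite chain_atS; apply: (is_rep_cat _ _ 2 _ 2 _ _ vT vC rT rr).
  case: bot => b0 b1; case: junction => j0 j1.
  by case=> [|[|//]] _; [rewrite b0 j0|rewrite b1 j1].
case=> [_|i hi]; last first.
  rewrite chain_atS size_cat; have := hr i hi; rewrite addSnnS.
  by rewrite /inverse_pair glueD.
(* If [T m] has no slices, level 0 of the glued representation belongs to [r], and the top and
   bottom pairs of [T m] coincide. *)
rewrite addn0 /= /glue; case: posnP => [s0|//]; rewrite s0 in bot *.
move: junction; case: top => [t0 t1]; case: bot => [b0 b1].
by rewrite /inverse_pair -t0 b0.
Qed.

Lemma denominator_rep (s : diagram) (r : nat -> level) (x : M2) : valid 2 s 2 ->
  is_rep 2 s r -> inSL2 x -> inverse_pair (r 0%N) x -> inverse_pair (r (size s)) x ->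
  exists2 R, is_rep 0 (denominator s) R &
    forall k, (k <= size s)%N -> (0 < wid 2 s k)%N -> (k.+2 <= size (denominator s))%N /\
      (1 < wid 0 (denominator s) k.+2)%N /\ R k.+2 1%N = r k 0%N.
Proof.
move=> v rep dx top bot.
(* Across four strands the values alternate, starting with [invmx x]: the outer strands carry the
   inverses of the tangle ends to which they are joined. *)
pose al : level := fun j => if odd j then x else invmx x.
have dal j : inSL2 (al j) by rewrite /al; case: ifP => _; [exact: dx|exact: det_inv1].
pose caps : diagram := [:: Birth 0; Birth 2]; pose cups : diagram := [:: Death 2; Death 0].
have rcaps : is_rep 0 caps (fun=> al).
  split=> [q _|]; first exact: dal.
  case=> [|[|//]] _; rewrite /wid /=; (split; [by []|split; last by rewrite /al /= invmxK]) => *; exfalso; lia.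
have rcups : is_rep 4 cups (fun=> al).
  split=> [q _|]; first exact: dal.
  case=> [|[|//]] _; rewrite /wid /=; (split; [by []|split; last by rewrite /al /= invmxK]) => *; exfalso; lia.
pose rmid k := pad (wid 2 s k) (invmx x) x (r k).
have vmid : valid 4 (map shift_piece s) 4 by apply: valid_shift v.
have rmidP : is_rep 4 (map shift_piece s) rmid.
  by apply: (is_rep_pad _ _ 2 _ _ _ v) => //; exact: det_inv1.
have ends (z : level) : inverse_pair z x ->
    forall j, (j < 4)%N -> pad 2 (invmx x) x z j = al j.
  by case=> z0 z1 [|[|[|[|//]]]] _ /=; rewrite ?z0 ?z1 /al.
have rlow : is_rep 4 (map shift_piece s ++ cups) (glue (size (map shift_piece s)) rmid (fun=> al)).
  apply: (is_rep_cat _ _ 4 _ 0 _ _ vmid _ rmidP rcups); first by [].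
  move=> j hj; rewrite size_map /rmid (wid_size _ _ _ v).
  exact: ends bot j hj.
have vlow : valid 4 (map shift_piece s ++ cups) 0 by apply: valid_cat vmid _.
exists (glue (size caps) (fun=> al) (glue (size (map shift_piece s)) rmid (fun=> al))).
  apply: (is_rep_cat _ _ 4 _ 0 _ _ _ vlow rcaps rlow); first by [].
  move=> j hj; rewrite /glue size_map; case: posnP => [s0|sp]; first exact: erefl.
  by rewrite /rmid /wid take0 /= -(ends _ top j hj).
move=> k ks w0; have sz : size (denominator s) = (size s + 4)%N.
  by rewrite /denominator !size_cat size_map /=; lia.
split; [by rewrite sz; lia|split].
  have -> : wid 0 (denominator s) k.+2 = wid 4 (map shift_piece s ++ cups) k.
    exact: (wid_catr 0 caps 4 _ k).
  by rewrite wid_catl ?size_map // (wid_shift _ _ _ _ v ks).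
rewrite -[k.+2]/(size caps + k)%N glueD /glue size_map; case: ltnP => hk.
  by rewrite /rmid /= w0.
have -> : k = size s by apply/eqP; rewrite eqn_leq ks.
by case: bot => -> _.
Qed.

(** * Characters of polygons *)

(** The upper left end of [T i] as a point of the denominator: two caps lie above the tangles and
    one strand lies to their left. *)
Definition joint (T : nat -> diagram) (i : nat) : nat * nat :=
  ((size (chain_at T 0 i)).+2, 1%N).

Definition meridian_word (T : nat -> diagram) : word := [:: (joint T 1, false)].

Definition diagonal_word (T : nat -> diagram) (i : nat) : word :=
  [:: (joint T i, false); (joint T 1, true)].

Definition top_of (rho : nat -> nat -> level) i : M2 := rho i 0%N 0%N.
Definition bottom_of (T : nat -> diagram) (rho : nat -> nat -> level) i : M2 :=
  rho i (size (T i)) 0%N.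

(** Each tangle representation is conjugated so that its left ends become the vertices [x i] and
    [x i.+1]; neighbouring tangles then agree at their junction, and the closed polygon allows the
    chain to be closed. *)
Lemma character_of_polygon (t : C) n (T : nat -> diagram) (rho : nat -> nat -> level) x :
  (0 < n)%N -> (forall i, (i <= n)%N -> tangle22 (T i)) ->
  (forall i, (i <= n)%N -> is_rep 2 (T i) (rho i) /\ g_rho (T i) (rho i) = 1%:M) ->
  polygon t (top_of rho) (bottom_of T rho) n x ->
  exists2 chi, Xirr (denominator (vcomp_n T n)) chi &
    chi (meridian_word T) = t /\
    forall i, (i <= n)%N -> chi (diagonal_word T i) = \tr (x i *m invmx (x 1%N)).
Proof.
move=> n0 vT repT [xc xe x1t nx1n].
have [g hg] : exists g : nat -> M2, forall i, (i <= n)%N ->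
    [/\ g i \in unitmx, x i = conj_mx (g i) (top_of rho i) &
       x i.+1 = conj_mx (g i) (bottom_of T rho i)].
  apply: (sig_choice (fun i gi => (i <= n)%N ->
    [/\ gi \in unitmx, x i = conj_mx gi (top_of rho i) &
       x i.+1 = conj_mx gi (bottom_of T rho i)])) => i.
  have [hi|hi] := leqP i n; last by exists 1%:M.
  by have [gi hgi] := xe i hi; exists gi.
pose sg i : nat -> level := fun k j => conj_mx (g i) (rho i k j).
have pieces i : (i <= n)%N -> [/\ tangle22 (T i), is_rep 2 (T i) (sg i),
     inverse_pair (sg i 0%N) (x i) & inverse_pair (sg i (size (T i))) (x i.+1)].
  move=> hi; have [gu xi xi1] := hg i hi; have [rp gr] := repT i hi.
  have [[_ p1] [_ q1]] := tangle_inverse_pairs _ _ (vT i hi) rp gr.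
  split; first exact: vT.
  - exact: is_rep_conj.
  - by split; rewrite xi /sg /= ?p1 ?invmx_conj.
  by split; rewrite xi1 /sg /= ?q1 ?invmx_conj.
have dx i : (i <= n)%N -> inSL2 (x i).
  move=> hi; have [v [p _] [<- _] _] := pieces i hi.
  by apply: (p (0%N, 0%N)); rewrite /point_ok /= /wid take0.
have [||r rr hr] := rep_chain T sg x 0 n.+1.
- by move=> i hi; apply: pieces; lia.
- by rewrite add0n xc; apply: dx.
have vS : valid 2 (vcomp_n T n) 2.
  by apply: (valid_chain T 0 n.+1) => i hi; apply: vT; lia.
have [|||R rR hR] := denominator_rep (vcomp_n T n) r (x 0%N) vS rr.
- exact: dx.
- by have := hr 0%N isT.
- by have := hr n.+1 (leqnn _); rewrite add0n xc.
have at_joint i : (i <= n)%N ->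
    [/\ ((joint T i).1 <= size (denominator (vcomp_n T n)))%N,
        ((joint T i).2 < wid 0 (denominator (vcomp_n T n)) (joint T i).1)%N &
        R (joint T i).1 (joint T i).2 = x i].
  move=> hi; have [e0 _] := hr i (leqW hi).
  have eS : vcomp_n T n = chain_at T 0 i ++ chain_at T i (n.+1 - i).
    rewrite /vcomp_n /chain_at -flatten_cat -map_cat.
    by rewrite -[in LHS](subnKC (leqW hi)) iotaD.
  have vi : valid 2 (chain_at T 0 i) 2 by apply: valid_chain => j hj; apply: vT; lia.
  have [||h1 [h2 h3]] := hR (size (chain_at T 0 i)).
  - by rewrite eS size_cat leq_addr.
  - by rewrite eS wid_catl // (wid_size _ _ _ vi).
  by split; [exact: h1|exact: h2|rewrite [LHS]h3 e0].
set D := denominator _ in rR hR at_joint *.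
have evalj i w : (i <= n)%N -> eval_word D R ((joint T i, false) :: w) = x i *m eval_word D R w.
  by move=> hi; have [h1 h2 h3] := at_joint i hi; rewrite /eval_word /= h1 h2 -h3.
have evali i w : (i <= n)%N -> eval_word D R ((joint T i, true) :: w) =
    invmx (x i) *m eval_word D R w.
  by move=> hi; have [h1 h2 h3] := at_joint i hi; rewrite /eval_word /= h1 h2 -h3.
exists (character D R); last first.
  split; first by rewrite /character /meridian_word evalj // mulmx1.
  by move=> i hi; rewrite /character /diagonal_word evalj // evali // mulmx1.
exists R; split; [exact: rR|split; last by []].
(* A common eigenvector of [x 1] and [x n] would be killed by their commutator, which is
   invertible. *)
case=> v [v0 hv].
have ev i : (i <= n)%N -> exists l, x i *m v = l *: v.
  by move=> hi; have [l] := hv [:: (joint T i, false)]; rewrite evalj // mulmx1; exists l.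
have [l1 e1] := ev 1%N n0; have [l2 e2] := ev n (leqnn n).
apply: v0; apply: (mulmx_inj0 _ _ nx1n).
by rewrite mulmxBl -!mulmxA e1 e2 -!scalemxAr e1 e2 !scalerA mulrC subrr.
Qed.

(** The trace [t] of a meridian is the first free value, and the [m] diagonals follow. Nothing is
    assumed on how [rho] depends on [t], as [large] treats each [t] separately. *)
Lemma dim_ge_polygons n m (T : nat -> diagram) (F : seq C) :
  (m.+2 <= n)%N -> (forall i, (i <= n)%N -> tangle22 (T i)) ->
  (forall t : C, t \notin F -> exists2 rho : nat -> nat -> level,
     (forall i, (i <= n)%N -> is_rep 2 (T i) (rho i) /\ g_rho (T i) (rho i) = 1%:M) &
     large m (fun cs => exists2 x, polygon t (top_of rho) (bottom_of T rho) n x &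
       [seq \tr (x i *m invmx (x 1%N)) | i <- rev (iota 3 m)] = cs)) ->
  dim_ge (Xirr (denominator (vcomp_n T n))) m.+1.
Proof.
move=> mn vT h; have n0 : (0 < n)%N by lia.
pose ws := meridian_word T :: map (diagonal_word T) (rev (iota 3 m)).
have -> : m.+1 = size ws by rewrite /= size_map size_rev size_iota.
apply: dim_ge_large; first exact: dcc_Xirr.
have -> : size ws = m.+1 by rewrite /= size_map size_rev size_iota.
apply: (infinitely_many_cofinite F) => t /h[rho repT hl].
apply: largeW hl => cs _ [x px xc].
have [chi hchi [c1 c2]] := character_of_polygon t n T rho x n0 vT repT px.
exists chi; first exact: hchi.
rewrite /= c1; congr (_ :: _); rewrite -map_comp -xc; apply/eq_in_map => i.
rewrite mem_rev mem_iota => hi; apply: c2; lia.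
Qed.

(** * From the tangles to the dimension bounds *)

Lemma generic_tangle (t : C) (s : diagram) (r : nat -> level) :
  tangle22 s -> in_Rt t s r ->
  in_SL2t t (r 0%N 0%N) /\ in_SL2t t (r (size s) 0%N).
Proof.
move=> v [_ h]; split.
  have [|d _ _ tr] := h (0%N, 0%N); [|by split].
  by split; rewrite //= /wid take0.
have [|d _ _ tr] := h (size s, 0%N); [|by split].
by split; rewrite /= ?(wid_size _ _ _ v).
Qed.

(** The northwest arc is directed outward, so [tr_v] is the trace of the lower left value times the
    inverse of the upper left one, as in [det_comm]. *)
Lemma generic_pair_of_tangle (t : C) (s : diagram) (r : nat -> level) :
  tangle22 s -> in_Rt t s r -> tr_v s r <> 2 -> tr_v s r <> t ^+ 2 - 2 ->
  generic_pair t (r 0%N 0%N) (r (size s) 0%N).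
Proof.
move=> v hr n1 n2; have [ga gb] := generic_tangle t s r v hr.
split; [exact: ga|exact: gb|exact: det_comm_neq0 ga gb n1 n2].
Qed.

Theorem theorem3p2 (n : nat) (T : nat -> diagram) :
  (3 <= n)%N ->
  (forall i, (i <= n)%N -> tangle22 (T i)) ->
  is_knot (denominator (vcomp_n T n)) ->
  (exists F : seq C, forall t : C, t \notin F ->
     exists rho : nat -> nat -> level,
       (forall i, (i <= n)%N ->
          in_Rt t (T i) (rho i) /\ g_rho (T i) (rho i) = 1%:M) /\
       (forall i, (1 <= i <= n)%N ->
          tr_v (T i) (rho i) <> 2 /\ tr_v (T i) (rho i) <> t ^+ 2 - 2)) ->
  dim_ge (Xirr (denominator (vcomp_n T n))) (n - 2) /\
  ((exists F : seq C, forall t : C, t \notin F ->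
     exists rho : nat -> nat -> level,
       (forall i, (i <= n)%N ->
          in_Rt t (T i) (rho i) /\ g_rho (T i) (rho i) = 1%:M) /\
       (forall i, (1 <= i <= n)%N ->
          tr_v (T i) (rho i) <> 2 /\ tr_v (T i) (rho i) <> t ^+ 2 - 2) /\
       rho_ne (T 0%N) (rho 0%N) *m rho_se (T 0%N) (rho 0%N)
         <> rho_se (T 0%N) (rho 0%N) *m rho_ne (T 0%N) (rho 0%N)) ->
   dim_ge (Xirr (denominator (vcomp_n T n))) (n - 1)).
Proof.
move=> n3 vT _ [F hF]; split.
  have -> : (n - 2 = (n - 3).+1)%N by lia.
  (* At 2 and -2 distinct eigenvalues are lost; 0 is excluded for [exists_noncommuting]. *)
  apply: (dim_ge_polygons n (n - 3) T (F ++ [:: 0; 2; - 2])) => [|//|t]; first by lia.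
  rewrite mem_cat !inE !negb_or => /andP[/hF[rho [hR hv]] /and3P[/eqP t0 /eqP t1 /eqP t2]].
  exists rho; first by move=> i /hR[[]].
  have [g0 g1] := generic_tangle t _ _ (vT 0%N isT) (proj1 (hR 0%N isT)).
  apply: polygons => // i hi; have hi' : (i <= n)%N by lia.
  have [v1 v2] := hv i hi.
  exact: generic_pair_of_tangle (vT i hi') (proj1 (hR i hi')) v1 v2.
move=> [F' hF'].
have -> : (n - 1 = (n - 2).+1)%N by lia.
apply: (dim_ge_polygons n (n - 2) T (F' ++ [:: 2; - 2])) => [|//|t]; first by lia.
rewrite mem_cat !inE !negb_or => /andP[/hF'[rho [hR [hv hnc]]] /andP[/eqP t1 /eqP t2]].
exists rho; first by move=> i /hR[[]].
have [hR0 hg0] := hR 0%N isT.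
have [g0 g1] := generic_tangle t _ _ (vT 0%N isT) hR0.
apply: polygons_noncommuting => //; last first.
  have [[p1 p2] [q1 q2]] := tangle_inverse_pairs _ _ (vT 0%N isT) (proj1 hR0) hg0.
  (* The northeast value is [a 0] and the southeast value is the inverse of [b 0], so these commute
     when [a 0] and [b 0] do. *)
  move=> /subr0_eq hc; apply: hnc; rewrite /rho_ne /rho_se p2 q2 invmxK.
  have u0 := unit_det1 _ (proj1 g0); have u1 := unit_det1 _ (proj1 g1).
  rewrite -[LHS](mulKmx u1) (mulmxA (rho 0%N (size (T 0%N)) 0%N)) -hc.
  by rewrite -!mulmxA (mulmxV u1) mulmx1.
move=> i hi; have hi' : (i <= n)%N by lia.
have [v1 v2] := hv i hi.
exact: generic_pair_of_tangle (vT i hi') (proj1 (hR i hi')) v1 v2.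
Qed.
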